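(* Let $\alpha\in(0,1)$. (I) Suppose $F\in\mathbb{P}(\mathbb{Z}^+)$ is aperiodic and there exist $\varepsilon\in(0,1)$ and $c>0$ such that $1-\mathrm{Re}\,\widehat{F}(\xi)\ge\varepsilon|\xi|^{\alpha}$ for all $\xi\in[-\varepsilon,\varepsilon]$, and $|\partial_\xi\widehat{F}(\xi)|\le c|\xi|^{\alpha-1}$ for all $\xi\in[-\pi,\pi]\setminus\{0\}$. Then $F\in\mathcal{A}$. (II) Let $F,G\in\mathbb{P}(\mathbb{Z}^+)$ be aperiodic, with $F$ satisfying the hypotheses of part (I) (for this $\alpha$). If there exists $a>0$ such that $\sum_{k\ge1}k|G(k)-aF(k)|<\infty$, then $G$ also satisfies the hypotheses of part (I) (for this $\alpha$, with suitable constants $\varepsilon,c$), and hence $G\in\mathcal{A}$.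
   Context: $\mathbb{P}(\mathbb{Z}^+)$ is the set of functions $F:\mathbb{Z}\to[0,1]$ with $\sum_kF(k)=1$ and $F(k)=0$ for $k<0$. $\widehat{F}(\xi)=\sum_kF(k)e^{-ik\xi}$ for $\xi\in[-\pi,\pi]$; $\partial_\xi$ denotes derivative in $\xi$. $F$ is adapted if $\mathrm{supp}(F)$ generates the group $\mathbb{Z}$, and aperiodic if every translate $\delta_m*F$, $m\in\mathbb{Z}$, is adapted ($\delta_m$ the point mass at $m$). $F^{(n)}$ is the $n$-th convolution power, and $\mathcal{A}=\{F\in\mathbb{P}(\mathbb{Z}^+):\sup_{n\in\mathbb{N}}n\sum_k|F^{(n)}(k)-F^{(n+1)}(k)|<\infty\}$. *)

(* Defs.v *)
From Stdlib Require Import Reals ZArith Lra.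
From Coquelicot Require Import Coquelicot.
Open Scope R_scope.

Definition probZp (F : Z -> R) : Prop :=
  (forall k, 0 <= F k <= 1) /\
  (forall k, (k < 0)%Z -> F k = 0) /\
  is_series (fun n : nat => F (Z.of_nat n)) 1.

(* Fourier transform  \hat F(xi) = sum_k F(k) e^{-i k xi}, for F supported on Z^+,
   written via its real and imaginary parts. *)
Definition Fhat (F : Z -> R) (xi : R) : C :=
  (Series (fun n : nat => F (Z.of_nat n) * cos (INR n * xi)),
   Series (fun n : nat => - (F (Z.of_nat n) * sin (INR n * xi)))).

Definition powabs (x a : R) : R :=
  if Req_EM_T x 0 then 0 else Rpower (Rabs x) a.

Definition subgroupZ (H : Z -> Prop) : Prop :=
  H 0%Z /\ (forall x y, H x -> H y -> H (x + y)%Z) /\ (forall x, H x -> H (- x)%Z).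

Definition adapted (F : Z -> R) : Prop :=
  forall H, subgroupZ H -> (forall k, F k <> 0 -> H k) -> forall z, H z.

Definition translate (m : Z) (F : Z -> R) : Z -> R := fun k => F (k - m)%Z.

Definition aperiodic (F : Z -> R) : Prop := forall m, adapted (translate m F).

Definition convZp (F G : Z -> R) : Z -> R := fun k =>
  if (k <? 0)%Z then 0
  else sum_f_R0 (fun j : nat => F (Z.of_nat j) * G (k - Z.of_nat j)%Z) (Z.to_nat k).

Definition deltaZ (m : Z) : Z -> R := fun k => if Z.eqb k m then 1 else 0.

Fixpoint convpow (F : Z -> R) (n : nat) : Z -> R :=
  match n with
  | O => deltaZ 0
  | S n' => convZp F (convpow F n')
  end.

Definition classA (F : Z -> R) : Prop :=
  probZp F /\
  exists M : R, forall n : nat,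
    INR n * Series (fun k : nat =>
      Rabs (convpow F n (Z.of_nat k) - convpow F (S n) (Z.of_nat k))) <= M.

Definition hypI (alpha : R) (F : Z -> R) : Prop :=
  exists eps c : R, 0 < eps < 1 /\ 0 < c /\
    (forall xi, - eps <= xi <= eps ->
       1 - fst (Fhat F xi) >= eps * powabs xi alpha) /\
    (forall xi, - PI <= xi <= PI -> xi <> 0 ->
       exists d : C, is_derive (Fhat F) xi d /\
         Cmod d <= c * Rpower (Rabs xi) (alpha - 1)).

(* Main.v *)
(* Let f be the Fourier transform of F. The derivative bound gives
   |1 - f(x)| <= C |x|^alpha, and with the lower bound on 1 - Re f and
   aperiodicity (|f| < 1 off 2 pi Z) also |f(x)| <= exp(-k |x|^alpha). Hence
   h = f^n (1 - f), whose Fourier coefficients are F^(n) - F^(n+1), satisfies,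
   with N = n^(1/alpha) and b = alpha/2 < 1/2,
     |h| <= C/n (N x)^b,  |h| <= C/n (1 + N x)^(-(1-b)),  |h'| <= C/n (N x)^b / x.
   For alpha <= 1/2 the derivative h' need not be in L^2, so the l^1 norm of the
   coefficients is bounded as in Bernstein's theorem: Bessel's inequality for
   x |-> h(x+d) - h(x-d) with d = pi/(4T) controls the coefficients in (T, 2T],
   and summing over T = m 2^j with m close to N gives a geometric series.
   In part (II), the transform of G is a f plus a function with bounded
   derivative, which is of lower order than |x|^alpha at 0. *)
Require Import Defs.
From Stdlib Require Import Reals ZArith Lra Lia.
From Coquelicot Require Import Coquelicot.
Open Scope R_scope.

(** * Trigonometric series and Bessel's inequality *)

(** The coefficients are real, so the modulus of a transform is even and Parseval's identity already
    holds on the half period [0, pi]. The estimates are nevertheless needed up to 3 pi/2, because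
    the shifted point x+d leaves [0, pi]; beyond pi they come from periodicity. The shift d =
    pi/(4T) puts k d between pi/4 and pi/2 for every k in (T, 2T], so the multiplier sin(k d) that
    the difference produces stays away from 0 on the whole block. The exponent b is confined from
    both sides. With b < 1/2 the weight (1 + x/d)^(-(1-b)), which dominates the difference of h, is
    square integrable with integral of order d; with b > 0 the blocks, of size (N/T)^b, are
    summable. The choice alpha/2 meets both conditions and is below alpha: since x^alpha = (N
    x)^alpha / n, the singularity x^(alpha-1) of f' then fits into the bound on h', while exp(-k n
    x^alpha) absorbs any surplus power of N x. *)

Lemma ex_series_dom (u b : nat -> R) :
  (forall k, Rabs (u k) <= b k) -> ex_series b ->
  ex_series (fun k => Rabs (u k)).
Proof.
  intros Hle Hb; apply (ex_series_le (fun k => Rabs (u k)) b); [|exact Hb].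
  intros k; change (Rabs (Rabs (u k)) <= b k); rewrite Rabs_Rabsolu; apply Hle.
Qed.

Lemma ex_series_dom' (u b : nat -> R) :
  (forall k, Rabs (u k) <= b k) -> ex_series b -> ex_series u.
Proof. intros Hle Hb; apply ex_series_Rabs, (ex_series_dom u b Hle Hb). Qed.

Lemma Series_abs_le (u b : nat -> R) :
  (forall k, Rabs (u k) <= b k) -> ex_series b -> Rabs (Series u) <= Series b.
Proof.
  intros Hle Hb; eapply Rle_trans; [apply Series_Rabs, (ex_series_dom u b Hle Hb)|].
  apply Series_le; [|exact Hb]; intros k; split; [apply Rabs_pos|apply Hle].
Qed.

(** The cut-off depends on the majorant alone, so one truncation serves every [u] below it, in
    particular all points x of a trigonometric series at once. *)
Lemma Series_tail_unif (b : nat -> R) :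
  ex_series b -> forall e, 0 < e ->
  exists K0, forall K, (K0 <= K)%nat -> forall u,
    (forall k, Rabs (u k) <= b k) -> Rabs (Series u - sum_f_R0 u K) <= e.
Proof.
  intros Hb e He.
  assert (Hlim : is_series b (Series b)) by now apply Series_correct.
  apply is_series_Reals in Hlim; destruct (Hlim e He) as [K0 HK0].
  exists K0; intros K HK u Hu.
  rewrite (Series_incr_n u (S K)); [|lia|now apply (ex_series_dom' u b)].
  simpl Nat.pred; ring_simplify (sum_f_R0 u K + Series (fun k => u (S K + k)%nat) - sum_f_R0 u K).
  assert (Hbk : ex_series (fun k => b (S K + k)%nat)) by now apply (ex_series_incr_n b (S K)).
  eapply Rle_trans; [apply (Series_abs_le _ (fun k => b (S K + k)%nat)); [intros; apply Hu|exact Hbk]|].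
  assert (H := HK0 K HK); unfold Rdist in H; apply Rabs_def2 in H.
  rewrite (Series_incr_n b (S K)) in H by (lia || assumption); simpl Nat.pred in H; lra.
Qed.

Lemma sum_f_R0_le_Series (b : nat -> R) K :
  (forall k, 0 <= b k) -> ex_series b -> sum_f_R0 b K <= Series b.
Proof.
  intros Hpos Hb; apply Series_correct in Hb.
  rewrite <- sum_n_Reals.
  apply (is_lim_seq_incr_compare (sum_n b) (Series b)); [exact Hb|].
  intros n; rewrite sum_Sn; change (sum_n b n <= sum_n b n + b (S n)).
  specialize (Hpos (S n)); lra.
Qed.

Lemma Series_le_bound (b : nat -> R) M :
  ex_series b -> (forall K, sum_f_R0 b K <= M) -> Series b <= M.
Proof.
  intros Hb HM; apply Series_correct in Hb.
  apply (is_lim_seq_le (sum_n b) (fun _ => M) (Series b) M).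
  - intros n; rewrite sum_n_Reals; apply HM.
  - exact Hb.
  - apply is_lim_seq_const.
Qed.

(* Convertible to [Fhat F] at [a := fun k => F (Z.of_nat k)]. *)
Definition trig (a : nat -> R) (x : R) : C :=
  (Series (fun k => a k * cos (INR k * x)),
   Series (fun k => - (a k * sin (INR k * x)))).

Lemma Rabs_cos_le1 x : Rabs (cos x) <= 1.
Proof. apply Rabs_le, COS_bound. Qed.

Lemma Rabs_sin_le1 x : Rabs (sin x) <= 1.
Proof. apply Rabs_le, SIN_bound. Qed.

Lemma Rabs_mul_le_l u v : Rabs v <= 1 -> Rabs (u * v) <= Rabs u.
Proof.
  intros Hv; rewrite Rabs_mult; rewrite <- (Rmult_1_r (Rabs u)) at 2.
  apply Rmult_le_compat_l; [apply Rabs_pos|exact Hv].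
Qed.

Lemma trig_re_le (a : nat -> R) x k : Rabs (a k * cos (INR k * x)) <= Rabs (a k).
Proof. apply Rabs_mul_le_l, Rabs_cos_le1. Qed.

Lemma trig_im_le (a : nat -> R) x k : Rabs (- (a k * sin (INR k * x))) <= Rabs (a k).
Proof. rewrite Rabs_Ropp; apply Rabs_mul_le_l, Rabs_sin_le1. Qed.

Definition Csum (a : nat -> R) (K : nat) (x : R) :=
  sum_f_R0 (fun k => a k * cos (INR k * x)) K.
Definition Ssum (a : nat -> R) (K : nat) (x : R) :=
  sum_f_R0 (fun k => - (a k * sin (INR k * x))) K.

Lemma is_RInt_ext_all (f g : R -> R) a b l :
  (forall x, f x = g x) -> is_RInt f a b l -> is_RInt g a b l.
Proof. intros H; apply is_RInt_ext; intros; apply H. Qed.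

Lemma is_RInt_lin (f g : R -> R) a b u v If Ig l :
  is_RInt f a b If -> is_RInt g a b Ig -> l = u * If + v * Ig ->
  is_RInt (fun x => u * f x + v * g x) a b l.
Proof.
  intros Hf Hg ->.
  exact (is_RInt_plus _ _ _ _ _ _ (is_RInt_scal f a b u If Hf) (is_RInt_scal g a b v Ig Hg)).
Qed.

Lemma is_RInt_cos_0_PI (m : nat) :
  (0 < m)%nat -> is_RInt (fun x => cos (INR m * x)) 0 PI 0.
Proof.
  intros Hm; assert (Hm' : INR m <> 0) by (apply not_0_INR; lia).
  replace 0 with (minus (/ INR m * sin (INR m * PI)) (/ INR m * sin (INR m * 0))) at 2.
  - apply (is_RInt_derive (fun x => / INR m * sin (INR m * x)) (fun x => cos (INR m * x))).
    + intros x _; auto_derive; [trivial|now field].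
    + intros x _; apply (ex_derive_continuous (V := R_NormedModule)); auto_derive; trivial.
  - rewrite Rmult_0_r, sin_0.
    replace (sin (INR m * PI)) with 0.
    + unfold minus, plus, opp; simpl; ring.
    + symmetry; apply sin_eq_0_1; exists (Z.of_nat m); now rewrite <- INR_IZR_INZ.
Qed.

(** The integrand is the real part of the partial sum times e^(iMx), hence the sum of the a_k
    cos((M-k)x) with M-k > 0. Only cosines of nonzero integer frequency occur, and these integrate
    to 0 over the half period. *)
Lemma is_RInt_cross (a : nat -> R) (K M : nat) : (K < M)%nat ->
  is_RInt (fun x => Csum a K x * cos (INR M * x) - Ssum a K x * sin (INR M * x)) 0 PI 0.
Proof.
  induction K as [|K IH]; intros HK.
  - apply (is_RInt_ext_all (fun x => a 0%nat * cos (INR M * x) + 0 * cos (INR M * x))).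
    + intros x; unfold Csum, Ssum; simpl; rewrite !Rmult_0_l, cos_0, sin_0; ring.
    + apply (is_RInt_lin _ _ _ _ _ _ 0 0); [apply is_RInt_cos_0_PI; lia..|ring].
  - apply (is_RInt_ext_all (fun x =>
      1 * (Csum a K x * cos (INR M * x) - Ssum a K x * sin (INR M * x))
      + a (S K) * cos (INR (M - S K) * x))).
    + intros x; unfold Csum, Ssum; rewrite 2!tech5, minus_INR by lia.
      rewrite Rmult_minus_distr_r, cos_minus; ring.
    + apply (is_RInt_lin _ _ _ _ _ _ 0 0); [apply IH; lia|apply is_RInt_cos_0_PI; lia|ring].
Qed.

Lemma parseval_finite (a : nat -> R) (K : nat) :
  is_RInt (fun x => (Csum a K x)^2 + (Ssum a K x)^2) 0 PI
    (PI * sum_f_R0 (fun k => (a k)^2) K).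
Proof.
  assert (Hc : forall c, is_RInt (fun _ => c) 0 PI (PI * c)).
  { intros c; replace (PI * c) with (scal (PI - 0) c) by (unfold scal; simpl; unfold mult; simpl; ring).
    apply @is_RInt_const. }
  induction K as [|K IH].
  - apply (is_RInt_ext_all (fun _ => (a 0%nat)^2)); [|apply Hc].
    intros x; unfold Csum, Ssum; simpl; rewrite !Rmult_0_l, cos_0, sin_0; ring.
  - apply (is_RInt_ext_all (fun x =>
      1 * ((Csum a K x)^2 + (Ssum a K x)^2) + 1 *
      ((2 * a (S K)) * (Csum a K x * cos (INR (S K) * x) - Ssum a K x * sin (INR (S K) * x))
       + 1 * (a (S K))^2))).
    + intros x; unfold Csum, Ssum; rewrite !tech5.
      assert (H := sin2_cos2 (INR (S K) * x)); unfold Rsqr in H.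
      replace ((a (S K))^2) with ((a (S K))^2 * (sin (INR (S K) * x) * sin (INR (S K) * x) + cos (INR (S K) * x) * cos (INR (S K) * x))) by (rewrite H; ring).
      ring.
    + rewrite tech5.
      eapply is_RInt_lin; [exact IH| |].
      * eapply is_RInt_lin; [apply (is_RInt_cross a K (S K)); lia|apply Hc|reflexivity].
      * ring.
Qed.

(* The bound is on [trig a] only: it is transferred to the partial sums, for which
   Parseval's identity is exact, up to the tail of [a]. *)
Lemma bessel (a : nat -> R) (W : R -> R) (A I : R) (K : nat) :
  ex_series (fun k => Rabs (a k)) ->
  is_RInt W 0 PI I -> 0 <= A * I ->
  (forall x, 0 <= x <= PI -> (Cmod (trig a x))^2 <= A * W x) ->
  sum_f_R0 (fun k => (a k)^2) K <= A * I.
Proof.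
  intros Ha HW HI Hbound.
  apply le_epsilon; intros e He.
  destruct (Series_tail_unif _ Ha (Rmin 1 (e / 4))) as [K0 HK0].
  { apply Rmin_pos; lra. }
  set (d := Rmin 1 (e / 4)) in *.
  assert (Hd : 0 < d <= 1 /\ d <= e / 4).
  { unfold d; repeat split; [apply Rmin_pos; lra|apply Rmin_l|apply Rmin_r]. }
  set (L := Nat.max K K0).
  assert (HL : sum_f_R0 (fun k => (a k)^2) K <= sum_f_R0 (fun k => (a k)^2) L).
  { unfold L; destruct (Nat.le_exists_sub K (Nat.max K K0)) as [p [-> _]]; [lia|].
    induction p as [|p IHp]; [simpl; lra|].
    change (S p + K)%nat with (S (p + K)); rewrite tech5; assert (0 <= (a (S (p + K)))^2) by apply pow2_ge_0; lra. }
  assert (HP := PI_RGT_0); assert (HP4 := PI2_3_2); unfold PI2 in HP4.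
  (* By c^2 <= 2 c'^2 + 2 (c' - c)^2, the squared partial sum is at most 2 A W + 4 d^2. The lost
     factor 2 is harmless: Parseval's identity carries a factor pi > 2. *)
  assert (Hint : PI * sum_f_R0 (fun k => (a k)^2) L <= 2 * A * I + 4 * d^2 * PI).
  { apply (is_RInt_le (fun x => (Csum a L x)^2 + (Ssum a L x)^2)
             (fun x => 2 * A * W x + 4 * d^2 * 1) 0 PI); [lra|apply parseval_finite| |].
    - eapply is_RInt_lin; [exact HW|apply @is_RInt_const|].
      unfold scal; simpl; unfold mult; simpl; ring.
    - intros x Hx.
      assert (Hx' := Hbound x ltac:(lra)).
      unfold Cmod in Hx'; rewrite pow2_sqrt in Hx' by (apply Rplus_le_le_0_compat; apply pow2_ge_0).
      unfold trig in Hx'; simpl fst in Hx'; simpl snd in Hx'.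
      assert (H1 := HK0 L ltac:(lia) _ (trig_re_le a x)).
      assert (H2 := HK0 L ltac:(lia) _ (trig_im_le a x)).
      fold (Csum a L x) in H1; fold (Ssum a L x) in H2.
      revert H1 H2 Hx'.
      generalize (Series (fun k => a k * cos (INR k * x))).
      generalize (Series (fun k => -(a k * sin (INR k * x)))).
      generalize (Csum a L x), (Ssum a L x).
      intros c s s' c' H1 H2 Hx'.
      apply Rabs_le_between in H1; apply Rabs_le_between in H2.
      assert ((c' - c)^2 <= d^2) by (rewrite <- (pow2_abs (c' - c)); apply pow_incr; split; [apply Rabs_pos|apply Rabs_le; lra]).
      assert ((s' - s)^2 <= d^2) by (rewrite <- (pow2_abs (s' - s)); apply pow_incr; split; [apply Rabs_pos|apply Rabs_le; lra]).
      assert (0 <= (2 * c' - c)^2) by apply pow2_ge_0.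
      assert (0 <= (2 * s' - s)^2) by apply pow2_ge_0.
      nra. }
  assert (d^2 <= e / 4) by nra.
  assert (PI * sum_f_R0 (fun k => (a k)^2) L <= PI * (A * I + e)) by nra.
  apply Rmult_le_reg_l in H0; lra.
Qed.

(** e^(-ik(x+d)) - e^(-ik(x-d)) = -2i sin(kd) e^(-ikx). The factor -i exchanges real and imaginary
    parts up to sign and disappears in the modulus. *)
Lemma trig_diff (a : nat -> R) (x d : R) :
  ex_series (fun k => Rabs (a k)) ->
  Cmod (trig a (x + d) - trig a (x - d)) =
  Cmod (trig (fun k => 2 * a k * sin (INR k * d)) x).
Proof.
  intros Ha.
  assert (Hre : fst (trig a (x + d) - trig a (x - d))%C =
                snd (trig (fun k => 2 * a k * sin (INR k * d)) x)).
  { unfold trig, Cminus, Cplus, Copp; simpl fst; simpl snd.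
    change (Series (fun k => a k * cos (INR k * (x + d)))
            - Series (fun k => a k * cos (INR k * (x - d))) =
            Series (fun k => - (2 * a k * sin (INR k * d) * sin (INR k * x)))).
    rewrite <- Series_minus.
    - apply Series_ext; intros k.
      rewrite Rmult_plus_distr_l, Rmult_minus_distr_l, cos_plus, cos_minus; ring.
    - apply (ex_series_dom' _ _ (trig_re_le a (x + d)) Ha).
    - apply (ex_series_dom' _ _ (trig_re_le a (x - d)) Ha). }
  assert (Him : snd (trig a (x + d) - trig a (x - d))%C =
                - fst (trig (fun k => 2 * a k * sin (INR k * d)) x)).
  { unfold trig, Cminus, Cplus, Copp; simpl fst; simpl snd.
    change (Series (fun k => - (a k * sin (INR k * (x + d))))
            - Series (fun k => - (a k * sin (INR k * (x - d)))) =
            - Series (fun k => 2 * a k * sin (INR k * d) * cos (INR k * x))).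
    rewrite <- Series_minus, <- Series_opp.
    - apply Series_ext; intros k.
      rewrite Rmult_plus_distr_l, Rmult_minus_distr_l, sin_plus, sin_minus; ring.
    - apply (ex_series_dom' _ _ (trig_im_le a (x + d)) Ha).
    - apply (ex_series_dom' _ _ (trig_im_le a (x - d)) Ha). }
  unfold Cmod; rewrite Hre, Him; f_equal; ring.
Qed.

(** * Mean value inequalities and real powers *)

Lemma is_derive_C (f : R -> C) x d :
  is_derive (fun t => fst (f t)) x (fst d) ->
  is_derive (fun t => snd (f t)) x (snd d) -> is_derive f x d.
Proof.
  intros H1 H2.
  apply (filterdiff_ext (fun t => (fst (f t), snd (f t)))).
  { intros; now rewrite <- surjective_pairing. }
  eapply filterdiff_ext_lin.
  - apply (filterdiff_comp'_2 (fun t => fst (f t)) (fun t => snd (f t))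
             (fun a b => (a,b):C) x _ _ (fun a b => (a,b):C) H1 H2).
    apply (filterdiff_ext (fun t:R*R => t)); [now intros []|].
    eapply filterdiff_ext_lin; [apply filterdiff_id|now intros []].
  - intros y; destruct d; reflexivity.
Qed.

Lemma is_derive_re (f : R -> C) x d :
  is_derive f x d -> is_derive (fun t => fst (f t)) x (fst d).
Proof.
  intros H; eapply filterdiff_ext_lin.
  - apply (filterdiff_comp' f (fst : C -> R) x _ fst H), filterdiff_linear, is_linear_fst.
  - reflexivity.
Qed.

Lemma is_derive_im (f : R -> C) x d :
  is_derive f x d -> is_derive (fun t => snd (f t)) x (snd d).
Proof.
  intros H; eapply filterdiff_ext_lin.
  - apply (filterdiff_comp' f (snd : C -> R) x _ snd H), filterdiff_linear, is_linear_snd.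
  - reflexivity.
Qed.

Lemma Cmod_re_le (z : C) : Rabs (fst z) <= Cmod z.
Proof. eapply Rle_trans; [apply Rmax_l|apply Rmax_Cmod]. Qed.

Lemma Cmod_im_le (z : C) : Rabs (snd z) <= Cmod z.
Proof. eapply Rle_trans; [apply Rmax_r|apply Rmax_Cmod]. Qed.

Lemma Cmod_le_abs (z : C) : Cmod z <= Rabs (fst z) + Rabs (snd z).
Proof.
  unfold Cmod; rewrite <- (pow2_abs (fst z)), <- (pow2_abs (snd z)).
  assert (H1 := Rabs_pos (fst z)); assert (H2 := Rabs_pos (snd z)).
  apply Rsqr_incr_0_var; [|lra].
  rewrite Rsqr_sqrt by (apply Rplus_le_le_0_compat; apply pow2_ge_0).
  unfold Rsqr; nra.
Qed.

Lemma mvt_abs (f : R -> R) x y D : x <= y ->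
  (forall z, x <= z <= y -> exists d, is_derive f z d /\ Rabs d <= D) ->
  Rabs (f y - f x) <= D * (y - x).
Proof.
  intros Hxy H.
  destruct (MVT_gen f x y (Derive f)) as [c [Hc Heq]].
  - intros z Hz; rewrite Rmin_left, Rmax_right in Hz by lra.
    destruct (H z ltac:(lra)) as [d [Hd _]]; apply Derive_correct; now exists d.
  - intros z Hz; rewrite Rmin_left, Rmax_right in Hz by lra.
    destruct (H z ltac:(lra)) as [d [Hd _]].
    apply continuity_pt_filterlim.
    apply (ex_derive_continuous (V := R_NormedModule) f z); now exists d.
  - rewrite Rmin_left, Rmax_right in Hc by lra.
    rewrite Heq, Rabs_mult, (Rabs_pos_eq (y - x)) by lra.
    destruct (H c Hc) as [d [Hd Hle]].
    rewrite (is_derive_unique _ _ _ Hd); apply Rmult_le_compat_r; lra.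
Qed.

(** The mean value theorem is applied to the real and imaginary parts separately, which costs the
    factor 2. *)
Lemma Cmod_mvt (f : R -> C) x y D : x <= y ->
  (forall z, x <= z <= y -> exists d, is_derive f z d /\ Cmod d <= D) ->
  Cmod (f y - f x) <= 2 * D * (y - x).
Proof.
  intros Hxy H.
  eapply Rle_trans; [apply Cmod_le_abs|].
  assert (H1 : Rabs (fst (f y) - fst (f x)) <= D * (y - x)).
  { apply (mvt_abs (fun t => fst (f t))); [exact Hxy|].
    intros z Hz; destruct (H z Hz) as [d [Hd Hle]]; exists (fst d); split;
      [now apply is_derive_re|eapply Rle_trans; [apply Cmod_re_le|exact Hle]]. }
  assert (H2 : Rabs (snd (f y) - snd (f x)) <= D * (y - x)).
  { apply (mvt_abs (fun t => snd (f t))); [exact Hxy|].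
    intros z Hz; destruct (H z Hz) as [d [Hd Hle]]; exists (snd d); split;
      [now apply is_derive_im|eapply Rle_trans; [apply Cmod_im_le|exact Hle]]. }
  unfold Cminus, Cplus, Copp; simpl; unfold Rminus in H1, H2; lra.
Qed.

Lemma Rpower_pos x y : 0 < Rpower x y.
Proof. apply exp_pos. Qed.

Lemma Rpower_1_base y : Rpower 1 y = 1.
Proof. unfold Rpower; rewrite ln_1, Rmult_0_r; apply exp_0. Qed.

Lemma Rpower_ge_1 x y : 1 <= x -> 0 <= y -> 1 <= Rpower x y.
Proof.
  intros Hx Hy; rewrite <- (Rpower_O x) by lra.
  destruct (Req_dec x 1) as [->|Hne]; [rewrite !Rpower_1_base; lra|].
  apply Rle_Rpower; lra.
Qed.

Lemma Rpower_le_id x y : 1 <= x -> y <= 1 -> Rpower x y <= x.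
Proof.
  intros Hx Hy; rewrite <- (Rpower_1 x) at 2 by lra.
  destruct (Req_dec x 1) as [->|Hne]; [rewrite !Rpower_1_base; lra|].
  apply Rle_Rpower; lra.
Qed.

Lemma Rpower_neg_le x y r : 0 < x <= y -> 0 <= r -> Rpower y (- r) <= Rpower x (- r).
Proof.
  intros Hx Hr; rewrite !Rpower_Ropp; apply Rinv_le_contravar; [apply Rpower_pos|].
  apply Rle_Rpower_l; lra.
Qed.

Lemma Rpower_div_decr (N y z b : R) : 0 < N -> b <= 1 -> 0 < y <= z ->
  Rpower (N * z) b / z <= Rpower (N * y) b / y.
Proof.
  intros HN Hb Hy.
  replace (N * z) with ((N * y) * (z / y)) by (field; lra).
  assert (Hzy : 1 <= z / y) by (apply (Rmult_le_reg_r y); [lra|field_simplify; lra]).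
  rewrite <- Rpower_mult_distr by nra.
  assert (H := Rpower_le_id (z / y) b Hzy Hb).
  assert (Hp := Rpower_pos (N * y) b).
  apply (Rmult_le_reg_r z); [lra|].
  replace (Rpower (N * y) b * Rpower (z / y) b / z * z) with (Rpower (N * y) b * Rpower (z / y) b) by (field; lra).
  replace (Rpower (N * y) b / y * z) with (Rpower (N * y) b * (z / y)) by (field; lra).
  apply Rmult_le_compat_l; lra.
Qed.

(** Since b < 1/2, the exponent 2(1-b) exceeds 1, so the squared weight is integrable on the whole
    half-line, with integral d/(1-2b). The function [P] of the proof is its explicit primitive. *)
Lemma integral_weight (b d : R) : 0 < b < 1/2 -> 0 < d ->
  exists I, is_RInt (fun x => Rpower (1 + x / d) (- (1 - b)) ^ 2) 0 PI I /\
    0 <= I <= d / (1 - 2 * b).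
Proof.
  intros Hb Hd; assert (HPI := PI_RGT_0).
  assert (Hpos : forall x, 0 <= x -> 0 < 1 + x / d).
  { intros x Hx; assert (0 <= x / d) by (apply Rle_mult_inv_pos; lra); lra. }
  set (P := fun x => - (d / (1 - 2 * b)) * Rpower (1 + x / d) (- (1 - 2 * b))).
  exists (P PI - P 0); split.
  - apply (is_RInt_derive P (fun x => Rpower (1 + x / d) (- (1 - b)) ^ 2)).
    + intros x Hx; rewrite Rmin_left, Rmax_right in Hx by lra.
      unfold P, Rpower; auto_derive; [apply Hpos; lra|].
      assert (Hp := Hpos x ltac:(lra)).
      change (exp (- (1 - b) * ln (1 + x / d))) with (Rpower (1 + x / d) (- (1 - b))).
      replace (Rpower (1 + x / d) (- (1 - b)) ^ 2)
        with (Rpower (1 + x / d) (- (1 - 2 * b)) * / (1 + x / d)).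
      * change (x * / d) with (x / d).
        change (exp (- (1 - 2 * b) * ln (1 + x / d))) with (Rpower (1 + x / d) (- (1 - 2 * b))).
        generalize (Rpower (1 + x / d) (- (1 - 2 * b))).
        intros r; field; repeat split; try lra.
      * simpl; rewrite Rmult_1_r, <- Rpower_plus.
        rewrite <- (Rpower_1 (1 + x / d)) at 2 by exact Hp.
        rewrite <- Rpower_Ropp, <- Rpower_plus; f_equal; ring.
    + intros x Hx; rewrite Rmin_left, Rmax_right in Hx by lra.
      apply (ex_derive_continuous (V := R_NormedModule)); unfold Rpower; auto_derive.
      apply Hpos; lra.
  - unfold P.
    replace (1 + 0 / d) with 1 by (field; lra); rewrite Rpower_1_base.
    assert (Hp := Rpower_pos (1 + PI / d) (- (1 - 2 * b))).
    assert (Rpower (1 + PI / d) (- (1 - 2 * b)) <= 1).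
    { apply Rle_trans with (Rpower 1 (- (1 - 2 * b))); [|rewrite Rpower_1_base; lra].
      apply Rpower_neg_le; [|lra].
      assert (0 <= PI / d) by (apply Rle_mult_inv_pos; lra); lra. }
    assert (0 < d / (1 - 2 * b)) by (apply Rdiv_lt_0_compat; lra).
    nra.
Qed.

(** * A Bernstein-type bound for absolute convergence *)

(** With real coefficients, reflection is complex conjugation. This covers x - d < 0, where no
    estimate is assumed. *)
Lemma Cmod_trig_opp (a : nat -> R) x : Cmod (trig a (- x)) = Cmod (trig a x).
Proof.
  unfold trig, Cmod; simpl fst; simpl snd; f_equal.
  rewrite (Series_ext (fun k => a k * cos (INR k * - x)) (fun k => a k * cos (INR k * x))).
  - rewrite (Series_ext (fun k => - (a k * sin (INR k * - x)))
               (fun k => - - (a k * sin (INR k * x)))).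
    + rewrite (Series_opp (fun k => - (a k * sin (INR k * x)))); ring.
    + intros k; rewrite Ropp_mult_distr_r_reverse, sin_neg; ring.
  - intros k; rewrite Ropp_mult_distr_r_reverse, cos_neg; ring.
Qed.

Section Bernstein.

Variables (b A N : R) (a : nat -> R).
Hypothesis Hb : 0 < b < 1/2.
Hypothesis HA : 0 < A.
Hypothesis HN : 1 <= N.
Hypothesis Ha : ex_series (fun k => Rabs (a k)).
Hypothesis Ha0 : trig a 0 = 0.
Hypothesis Hlow : forall x, 0 < x <= 3 * PI / 2 -> Cmod (trig a x) <= A * Rpower (N * x) b.
Hypothesis Hhigh : forall x, 0 < x <= 3 * PI / 2 ->
  Cmod (trig a x) <= A * Rpower (1 + N * x) (- (1 - b)).
Hypothesis Hder : forall x, 0 < x <= 3 * PI / 2 ->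
  exists d, is_derive (trig a) x d /\ Cmod d <= A * (Rpower (N * x) b / x).

(** For 0 <= x < 2d both x+d and x-d lie in [-d, 3d]. There [Hlow] suffices, with (3 N d)^b <= 3 (N
    d)^b. *)
Lemma near_zero_bound d y : 0 < d <= PI / 4 -> Rabs y <= 3 * d ->
  Cmod (trig a y) <= 3 * A * Rpower (N * d) b.
Proof.
  intros Hd Hy.
  assert (Hpos : forall z, 0 < z <= 3 * d -> Cmod (trig a z) <= 3 * A * Rpower (N * d) b).
  { intros z Hz; eapply Rle_trans; [apply Hlow; lra|].
    assert (Rpower (N * z) b <= 3 * Rpower (N * d) b).
    { apply Rle_trans with (Rpower (3 * (N * d)) b).
      - apply Rle_Rpower_l; [lra|]; split; nra.
      - rewrite <- Rpower_mult_distr by nra.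
        apply Rmult_le_compat_r; [left; apply Rpower_pos|apply Rpower_le_id; lra]. }
    nra. }
  destruct (Rtotal_order y 0) as [Hlt|[->|Hgt]].
  - rewrite <- (Ropp_involutive y), Cmod_trig_opp; apply Hpos.
    rewrite Rabs_left in Hy by lra; lra.
  - rewrite Ha0, Cmod_0; assert (H := Rpower_pos (N * d) b); nra.
  - apply Hpos; rewrite Rabs_right in Hy by lra; lra.
Qed.

(* For x >= 2d the mean value theorem applies away from the singularity at 0;
   for x < 2d both terms are small by the Hoelder bound at 0. *)
Lemma difference_bound d x : 0 < d <= PI / 4 -> 0 <= x <= PI ->
  Cmod (trig a (x + d) - trig a (x - d)) <=
    18 * A * Rpower (N * d) b * Rpower (1 + x / d) (- (1 - b)).
Proof.
  intros Hd Hx.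
  assert (Hp := Rpower_pos (N * d) b).
  assert (HAp : 0 < A * Rpower (N * d) b) by nra.
  assert (Hxd : 0 <= x / d) by (apply Rle_mult_inv_pos; lra).
  destruct (Rle_lt_dec (2 * d) x) as [Hfar|Hnear].
  - set (v := x / (2 * d)).
    assert (Hv : 1 <= v) by (unfold v; apply (Rmult_le_reg_r (2 * d)); [lra|]; field_simplify; lra).
    assert (Hxv : x = 2 * d * v) by (unfold v; field; lra).
    (* As d <= x/2, the interval [x-d, x+d] lies to the right of x/2, and the derivative bound
       decreases; its value at x/2 therefore serves throughout. *)
    assert (Hm := Cmod_mvt (trig a) (x - d) (x + d) (A * (Rpower (N * (x / 2)) b / (x / 2)))
              ltac:(lra)).
    eapply Rle_trans; [apply Hm|].
    + intros z Hz; destruct (Hder z ltac:(lra)) as [e [He1 He2]]; exists e; split; [exact He1|].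
      eapply Rle_trans; [exact He2|].
      apply Rmult_le_compat_l; [lra|]; apply Rpower_div_decr; lra.
    + replace (N * (x / 2)) with ((N * d) * v) by (rewrite Hxv; field).
      rewrite <- Rpower_mult_distr by nra.
      replace (2 * (A * (Rpower (N * d) b * Rpower v b / (x / 2))) * (x + d - (x - d)))
        with (4 * (A * Rpower (N * d) b) * (Rpower v b / v)) by (rewrite Hxv; field; lra).
      (* Here v^b / v = v^(-(1-b)) and 1 + x/d = 1 + 2v <= 3v, while 3 * 3^(-(1-b)) = 3^b >= 1. *)
      assert (Hkey : Rpower v b / v <= 3 * Rpower (1 + x / d) (- (1 - b))).
      { replace (1 + x / d) with (1 + 2 * v) by (unfold v; field; lra).
        apply Rle_trans with (3 * Rpower (3 * v) (- (1 - b))).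
        - rewrite <- Rpower_mult_distr by lra.
          replace (Rpower v b / v) with (Rpower v (- (1 - b))).
          + rewrite <- Rmult_assoc.
            rewrite <- (Rmult_1_l (Rpower v (- (1 - b)))) at 1.
            apply Rmult_le_compat_r; [left; apply Rpower_pos|].
            rewrite <- (Rpower_1 3) at 1 by lra; rewrite <- Rpower_plus.
            apply Rpower_ge_1; lra.
          + unfold Rdiv; rewrite <- (Rpower_1 v) at 3 by lra.
            rewrite <- Rpower_Ropp, <- Rpower_plus; f_equal; ring.
        - apply Rmult_le_compat_l; [lra|]; apply Rpower_neg_le; lra. }
      assert (H0 := Rpower_pos (1 + x / d) (- (1 - b))); nra.
  - assert (H1 : Cmod (trig a (x + d)) <= 3 * A * Rpower (N * d) b).
    { apply near_zero_bound; [lra|rewrite Rabs_right; lra]. }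
    assert (H2 : Cmod (trig a (x - d)) <= 3 * A * Rpower (N * d) b).
    { apply near_zero_bound; [lra|apply Rabs_le; lra]. }
    assert (H3 : Cmod (trig a (x + d) - trig a (x - d)) <=
              Cmod (trig a (x + d)) + Cmod (trig a (x - d))).
    { unfold Cminus; rewrite <- (Cmod_opp (trig a (x - d))); apply Cmod_triangle. }
    (* For x < 2d the weight is at least 1/3, so the two values, together at most 6 A (N d)^b, give
       the constant 18 = 6 * 3. The other case needs only 4 * 3. *)
    assert (H4 : / 3 <= Rpower (1 + x / d) (- (1 - b))).
    { assert (x / d <= 2) by (apply (Rmult_le_reg_r d); [lra|]; field_simplify; lra).
      apply Rle_trans with (Rpower 3 (- (1 - b))); [|apply Rpower_neg_le; lra].
      rewrite Rpower_Ropp; apply Rinv_le_contravar; [apply Rpower_pos|].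
      apply Rpower_le_id; lra. }
    nra.
Qed.

(** The energy is of order d (N d)^(2b). Spread over about T = pi/(4d) coefficients, it leads to an
    absolute sum of order (N/T)^b. *)
Lemma difference_energy d K : 0 < d <= PI / 4 ->
  sum_f_R0 (fun k => (2 * a k * sin (INR k * d))^2) K <=
    (18 * A * Rpower (N * d) b)^2 * (d / (1 - 2 * b)).
Proof.
  intros Hd; destruct (integral_weight b d Hb ltac:(lra)) as [I [HI HI']].
  assert (Hsq := pow2_ge_0 (18 * A * Rpower (N * d) b)).
  apply Rle_trans with ((18 * A * Rpower (N * d) b)^2 * I).
  - apply (bessel (fun k => 2 * a k * sin (INR k * d)) _ _ _ K) with (2 := HI).
    + apply (ex_series_dom _ (fun k => 2 * Rabs (a k))).
      * intros k; eapply Rle_trans; [apply Rabs_mul_le_l, Rabs_sin_le1|].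
        rewrite Rabs_mult, (Rabs_pos_eq 2) by lra; apply Rle_refl.
      * exact (ex_series_scal_l 2 _ Ha).
    + nra.
    + intros x Hx; rewrite <- Rpow_mult_distr; apply pow_incr; split; [apply Cmod_ge_0|].
      rewrite <- trig_diff by exact Ha; now apply difference_bound.
  - apply Rmult_le_compat_l; lra.
Qed.

Lemma low_energy K : sum_f_R0 (fun k => (a k)^2) K <= A^2 * (/ N / (1 - 2 * b)).
Proof.
  assert (HiN : 0 < / N) by (apply Rinv_0_lt_compat; lra).
  destruct (integral_weight b (/ N) Hb HiN) as [I [HI HI']].
  apply Rle_trans with (A^2 * I); [|apply Rmult_le_compat_l; [apply pow2_ge_0|lra]].
  apply (bessel a _ _ _ K Ha HI); [assert (H := pow2_ge_0 A); nra|].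
  intros x Hx; rewrite <- Rpow_mult_distr; apply pow_incr; split; [apply Cmod_ge_0|].
  destruct (Req_dec x 0) as [->|Hx0].
  - rewrite Ha0, Cmod_0; assert (H := Rpower_pos (1 + 0 / / N) (- (1 - b))); nra.
  - replace (x / / N) with (N * x) by (field; lra); apply Hhigh; lra.
Qed.

(** The arithmetic-geometric mean inequality. Summed over k with a free parameter l, it takes the
    place of the Cauchy-Schwarz inequality; l is balanced later. *)
Lemma abs_le_square (l u : R) : 0 < l -> Rabs u <= u^2 / (2 * l) + l / 2.
Proof.
  intros Hl; rewrite <- (pow2_abs u).
  apply (Rmult_le_reg_r (2 * l)); [lra|]; field_simplify; [|lra].
  assert (H := pow2_ge_0 (Rabs u - l)); nra.
Qed.

Lemma abs_sum_le_energy (l : R) K : 0 < l ->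
  sum_f_R0 (fun k => Rabs (a k)) K <=
    sum_f_R0 (fun k => (a k)^2) K / (2 * l) + INR (S K) * l / 2.
Proof.
  intros Hl.
  assert (Hterm := fun u => abs_le_square l u Hl).
  induction K as [|K IH].
  - simpl sum_f_R0; simpl INR; specialize (Hterm (a 0%nat)); lra.
  - rewrite !tech5, S_INR; specialize (Hterm (a (S K))).
    rewrite Rdiv_plus_distr; lra.
Qed.

Lemma sin_sq_ge_half y : PI / 4 <= y <= PI / 2 -> 1 / 2 <= sin y ^ 2.
Proof.
  intros Hy; assert (HPI := PI_RGT_0).
  assert (Hs : sin (PI / 4) <= sin y) by (apply sin_incr_1; lra).
  rewrite sin_PI4 in Hs.
  assert (H2 : 0 < sqrt 2) by (apply sqrt_lt_R0; lra).
  assert (Hpos : 0 < 1 / sqrt 2) by (apply Rdiv_lt_0_compat; lra).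
  apply Rle_trans with ((1 / sqrt 2)^2); [|apply pow_incr; lra].
  right; unfold Rdiv; rewrite Rpow_mult_distr, pow_inv, pow1, pow2_sqrt by lra; reflexivity.
Qed.

(** For T < k <= 2T the angle k pi/(4T) lies in [pi/4, pi/2], so its squared sine is at least 1/2
    and (2 a_k sin)^2 >= 2 a_k^2; hence the denominator 4l where [abs_le_square] has 2l. The energy
    of the terms k <= T is nonnegative and only enlarges the right side. *)
Lemma block_abs_sum (l : R) (T r : nat) : 0 < l -> (0 < T)%nat -> (r <= T)%nat ->
  sum_f_R0 (fun k => Rabs (a k)) (T + r) <=
    sum_f_R0 (fun k => Rabs (a k)) T
    + sum_f_R0 (fun k => (2 * a k * sin (INR k * (PI / (4 * INR T))))^2) (T + r) / (4 * l)
    + INR r * l / 2.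
Proof.
  intros Hl HT; assert (HT' : 0 < INR T) by now apply lt_0_INR.
  assert (HPI := PI_RGT_0).
  induction r as [|r IH]; intros Hr.
  - rewrite Nat.add_0_r; simpl INR.
    assert (0 <= sum_f_R0 (fun k => (2 * a k * sin (INR k * (PI / (4 * INR T))))^2) T / (4 * l)).
    { apply Rle_mult_inv_pos; [|lra]; apply cond_pos_sum; intros; apply pow2_ge_0. }
    lra.
  - rewrite Nat.add_succ_r, !tech5, (S_INR r).
    specialize (IH ltac:(lia)).
    set (k := S (T + r)).
    assert (Hs : 1 / 2 <= sin (INR k * (PI / (4 * INR T))) ^ 2).
    { apply sin_sq_ge_half.
      assert (Hk1 : INR T <= INR k) by (apply le_INR; unfold k; lia).
      assert (Hk2 : INR k <= 2 * INR T).
      { change 2 with (INR 2); rewrite <- mult_INR; apply le_INR; unfold k; lia. }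
      assert (Hd : 0 < PI / (4 * INR T)) by (apply Rdiv_lt_0_compat; lra).
      assert (E : INR T * (PI / (4 * INR T)) = PI / 4) by (field; lra).
      split; nra. }
    set (s := sin (INR k * (PI / (4 * INR T)))) in *.
    assert (Hterm : Rabs (a k) <= (2 * a k * s)^2 / (4 * l) + l / 2).
    { eapply Rle_trans; [apply (abs_le_square l (a k) Hl)|].
      apply Rplus_le_compat_r.
      replace ((a k)^2 / (2 * l)) with (2 * (a k)^2 / (4 * l)) by (field; lra).
      apply Rmult_le_compat_r; [left; apply Rinv_0_lt_compat; lra|].
      replace ((2 * a k * s)^2) with (4 * s^2 * (a k)^2) by ring.
      apply Rmult_le_compat_r; [apply pow2_ge_0|lra]. }
    rewrite Rdiv_plus_distr; fold k; lra.
Qed.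

(** The 18 comes from [difference_bound]. The root is that of the factor 1/(1-2b) in
    [integral_weight], since the energy acts through its square root. *)
Definition block_const := 18 / sqrt (1 - 2 * b).

Lemma block_const_pos : 0 < block_const.
Proof. apply Rdiv_lt_0_compat; [lra|apply sqrt_lt_R0; lra]. Qed.

Lemma block_const_sq : block_const ^ 2 = 324 / (1 - 2 * b).
Proof. unfold block_const, Rdiv; rewrite Rpow_mult_distr, pow_inv, pow2_sqrt by lra; f_equal; ring. Qed.

Lemma block_bound (T : nat) : (0 < T)%nat ->
  sum_f_R0 (fun k => Rabs (a k)) (2 * T) <=
    sum_f_R0 (fun k => Rabs (a k)) T + block_const * A * Rpower (N / INR T) b.
Proof.
  intros HT; assert (HT' : 1 <= INR T) by (apply (le_INR 1); lia).
  assert (HPI := PI_RGT_0); assert (HPI4 := PI_4).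
  set (d := PI / (4 * INR T)).
  assert (HTd : INR T * d = PI / 4) by (unfold d; field; lra).
  assert (Hd : 0 < d <= PI / 4) by (split; [unfold d; apply Rdiv_lt_0_compat; lra|nra]).
  set (q := Rpower (N / INR T) b).
  assert (Hq : 0 < q) by apply Rpower_pos.
  assert (HNT : 0 < N / INR T) by (apply Rdiv_lt_0_compat; lra).
  (* T d = pi/4 <= 1, so d <= 1/T. *)
  assert (Hqd : Rpower (N * d) b <= q).
  { apply Rle_Rpower_l; [lra|]; split; [nra|].
    apply (Rmult_le_reg_r (INR T)); [lra|].
    replace (N * d * INR T) with (N * (INR T * d)) by ring.
    replace (N / INR T * INR T) with N by (field; lra); nra. }
  (* The balanced choice: T l / 2 is exactly half of the claimed block bound, and the energy term
     fits into the other half. *)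
  set (l := block_const * A * q / INR T).
  assert (HC := block_const_pos).
  assert (HCA : 0 < block_const * A) by nra.
  assert (HCq : 0 < block_const * A * q) by nra.
  assert (Hl : 0 < l) by (apply Rdiv_lt_0_compat; lra).
  assert (H1 := block_abs_sum l T T Hl HT (le_n T)).
  replace (T + T)%nat with (2 * T)%nat in H1 by lia; fold d in H1.
  assert (H2 := difference_energy d (2 * T) Hd).
  assert (H3 : (18 * A * Rpower (N * d) b)^2 * (d / (1 - 2 * b)) <= 2 * l * (block_const * A * q)).
  { apply Rle_trans with ((18 * A * q)^2 * (/ INR T / (1 - 2 * b))).
    - apply Rmult_le_compat; [apply pow2_ge_0|apply Rle_mult_inv_pos; lra| |].
      + apply pow_incr; split; [assert (Hp := Rpower_pos (N * d) b); nra|].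
        apply Rmult_le_compat_l; [lra|exact Hqd].
      + apply Rmult_le_compat_r; [left; apply Rinv_0_lt_compat; lra|].
        apply (Rmult_le_reg_r (INR T)); [lra|]; rewrite Rinv_l by lra; lra.
    - unfold l.
      replace (2 * (block_const * A * q / INR T) * (block_const * A * q))
        with (2 * (block_const ^ 2 * A^2 * q^2 / INR T)) by (field; lra).
      rewrite block_const_sq.
      replace ((18 * A * q)^2 * (/ INR T / (1 - 2 * b)))
        with (324 / (1 - 2 * b) * A^2 * q^2 / INR T) by (field; lra).
      assert (0 <= 324 / (1 - 2 * b) * A^2 * q^2 / INR T); [|lra].
      apply Rle_mult_inv_pos; [|lra].
      assert (0 < 324 / (1 - 2 * b)) by (apply Rdiv_lt_0_compat; lra).
      assert (Hx := pow2_ge_0 A); assert (Hy := pow2_ge_0 q).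
      apply Rmult_le_pos; [apply Rmult_le_pos|]; lra. }
  assert (H4 : sum_f_R0 (fun k => (2 * a k * sin (INR k * d))^2) (2 * T) / (4 * l) <= block_const * A * q / 2).
  { apply (Rmult_le_reg_r (4 * l)); [lra|]; field_simplify; [|lra].
    eapply Rle_trans; [apply H2|]; lra. }
  assert (H5 : INR T * l / 2 = block_const * A * q / 2) by (unfold l; field; lra).
  lra.
Qed.

Lemma low_bound (m : nat) : N <= INR m -> INR (S m) <= 3 * N ->
  sum_f_R0 (fun k => Rabs (a k)) m <= block_const * A.
Proof.
  intros Hm HSm.
  assert (HC := block_const_pos); assert (HCA : 0 < block_const * A) by nra.
  (* With at most 3N terms, the part linear in l is at most half of the claimed bound; the energy
     takes the other half. *)
  set (l := block_const * A / (3 * N)).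
  assert (Hl : 0 < l) by (apply Rdiv_lt_0_compat; lra).
  assert (H1 := abs_sum_le_energy l m Hl).
  assert (H2 := low_energy m).
  assert (H3 : A^2 * (/ N / (1 - 2 * b)) <= l * (block_const * A)).
  { unfold l.
    replace (block_const * A / (3 * N) * (block_const * A)) with (block_const^2 * A^2 / (3 * N)) by (field; lra).
    rewrite block_const_sq.
    replace (324 / (1 - 2 * b) * A^2 / (3 * N)) with (108 * (A^2 * (/ N / (1 - 2 * b)))) by (field; lra).
    assert (0 <= A^2 * (/ N / (1 - 2 * b))); [|lra].
    apply Rmult_le_pos; [apply pow2_ge_0|].
    apply Rle_mult_inv_pos; [left; apply Rinv_0_lt_compat; lra|lra]. }
  assert (H4 : sum_f_R0 (fun k => (a k)^2) m / (2 * l) <= block_const * A / 2).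
  { apply (Rmult_le_reg_r (2 * l)); [lra|]; field_simplify; lra. }
  assert (H5 : INR (S m) * l / 2 <= block_const * A / 2).
  { replace (block_const * A) with (3 * N * l) by (unfold l; field; lra).
    apply Rmult_le_compat_r; [lra|]; apply Rmult_le_compat_r; lra. }
  lra.
Qed.

(** The block from T = m 2^j to 2T contributes at most a constant times A (2^(-b))^j, because N <=
    m. The resulting bound does not contain N, which is what makes it uniform in the convolution
    power. *)
Lemma abs_sum_bound K :
  sum_f_R0 (fun k => Rabs (a k)) K <= block_const * (1 + / (1 - Rpower (/ 2) b)) * A.
Proof.
  assert (HC := block_const_pos).
  destruct (nfloor_ex N ltac:(lra)) as [m0 Hm0].
  (* The integer part of N plus one: N <= m, and m + 1 <= N + 2 <= 3N because N >= 1. *)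
  set (m := S m0).
  assert (Hm : N <= INR m) by (unfold m; rewrite S_INR; lra).
  assert (HSm : INR (S m) <= 3 * N) by (unfold m; rewrite !S_INR; lra).
  set (q := Rpower (/ 2) b).
  assert (Hq : 0 < q < 1).
  { split; [apply Rpower_pos|].
    unfold q, Rpower; rewrite <- exp_0; apply exp_increasing.
    rewrite ln_Rinv by lra; assert (H := ln_lt_2); nra. }
  assert (Hind : forall j, sum_f_R0 (fun k => Rabs (a k)) (m * 2 ^ j) <=
            block_const * A + block_const * A * ((1 - q ^ j) / (1 - q))).
  { induction j as [|j IH].
    - simpl pow; simpl Nat.pow; rewrite Nat.mul_1_r.
      replace ((1 - 1) / (1 - q)) with 0 by (field; lra).
      assert (H := low_bound m Hm HSm); lra.
    - set (T := (m * 2 ^ j)%nat) in *.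
      assert (HT : (0 < T)%nat).
      { unfold T, m; apply Nat.mul_pos_pos; [lia|]; apply Nat.neq_0_lt_0, Nat.pow_nonzero; lia. }
      replace (m * 2 ^ S j)%nat with (2 * T)%nat by (unfold T; simpl; lia).
      eapply Rle_trans; [apply (block_bound T HT)|].
      assert (Hr : Rpower (N / INR T) b <= q ^ j).
      { unfold q; rewrite <- Rpower_pow by apply Rpower_pos.
        rewrite Rpower_mult, Rmult_comm, <- Rpower_mult, Rpower_pow by lra.
        apply Rle_Rpower_l; [lra|].
        assert (0 < INR T) by now apply lt_0_INR.
        split; [apply Rdiv_lt_0_compat; lra|].
        apply (Rmult_le_reg_r (INR T)); [lra|].
        replace (N / INR T * INR T) with N by (field; lra).
        unfold T; rewrite mult_INR, pow_INR.
        replace (INR 2) with 2 by reflexivity.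
        rewrite pow_inv, (Rmult_comm (INR m)), <- Rmult_assoc, Rinv_l by (apply pow_nonzero; lra).
        lra. }
      assert (E : (1 - q ^ S j) / (1 - q) = (1 - q ^ j) / (1 - q) + q ^ j) by (simpl; field; lra).
      rewrite E; assert (HCA : 0 < block_const * A) by nra; nra. }
  (* K doublings of m reach beyond index K, so the dyadic bound covers every partial sum. *)
  assert (HK : (K <= m * 2 ^ K)%nat).
  { assert (H := Nat.pow_gt_lin_r 2 K ltac:(lia)); unfold m; simpl; lia. }
  apply Rle_trans with (sum_f_R0 (fun k => Rabs (a k)) (m * 2 ^ K)).
  - destruct (Nat.le_exists_sub K (m * 2 ^ K) HK) as [p [-> _]].
    clear; induction p as [|p IH]; [simpl; lra|].
    change (S p + K)%nat with (S (p + K)); rewrite tech5; assert (H := Rabs_pos (a (S (p + K)))); lra.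
  - eapply Rle_trans; [apply Hind|].
    assert (H : (1 - q ^ K) / (1 - q) <= / (1 - q)).
    { unfold Rdiv; rewrite <- (Rmult_1_l (/ (1 - q))) at 2.
      apply Rmult_le_compat_r; [left; apply Rinv_0_lt_compat; lra|].
      assert (0 < q ^ K) by (apply pow_lt; lra); lra. }
    assert (HCA : 0 < block_const * A) by nra; nra.
Qed.

End Bernstein.

(** * Fourier transforms of convolution powers *)

(** The real and imaginary parts give four Cauchy products of absolutely convergent real series. The
    addition formulas for n x = i x + (n-i) x recombine them. *)
Lemma trig_cauchy (a b : nat -> R) x :
  ex_series (fun k => Rabs (a k)) -> ex_series (fun k => Rabs (b k)) ->
  trig (fun n => sum_f_R0 (fun k => a k * b (n - k)%nat) n) x = (trig a x * trig b x)%C.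
Proof.
  intros Ha Hb.
  assert (Hc : forall u : nat -> R, ex_series (fun k => Rabs (u k)) ->
            is_series (fun k => u k * cos (INR k * x)) (fst (trig u x)) /\
            ex_series (fun k => Rabs (u k * cos (INR k * x)))).
  { intros u Hu; split; [apply Series_correct, (ex_series_dom' _ _ (trig_re_le u x) Hu)
                        |apply (ex_series_dom _ _ (trig_re_le u x) Hu)]. }
  assert (Hs : forall u : nat -> R, ex_series (fun k => Rabs (u k)) ->
            is_series (fun k => - (u k * sin (INR k * x))) (snd (trig u x)) /\
            ex_series (fun k => Rabs (- (u k * sin (INR k * x))))).
  { intros u Hu; split; [apply Series_correct, (ex_series_dom' _ _ (trig_im_le u x) Hu)
                        |apply (ex_series_dom _ _ (trig_im_le u x) Hu)]. }
  destruct (Hc a Ha) as [ca ca'], (Hc b Hb) as [cb cb'].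
  destruct (Hs a Ha) as [sa sa'], (Hs b Hb) as [sb sb'].
  assert (Hcc := is_series_mult _ _ _ _ ca cb ca' cb').
  assert (Hss := is_series_mult _ _ _ _ sa sb sa' sb').
  assert (Hcs := is_series_mult _ _ _ _ ca sb ca' sb').
  assert (Hsc := is_series_mult _ _ _ _ sa cb sa' cb').
  unfold Cmult, trig at 1; f_equal; apply is_series_unique.
  - eapply is_series_ext; [|exact (is_series_minus _ _ _ _ Hcc Hss)].
    intros n; cbv beta.
    match goal with |- plus ?u (opp ?v) = _ => change (u - v = sum_f_R0 (fun k => a k * b (n - k)%nat) n * cos (INR n * x)) end.
    rewrite <- minus_sum, Rmult_comm, scal_sum; apply sum_eq; intros i Hi.
    replace (INR n * x) with (INR i * x + INR (n - i) * x) by (rewrite minus_INR by lia; ring).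
    rewrite cos_plus; ring.
  - eapply is_series_ext; [|exact (is_series_plus _ _ _ _ Hcs Hsc)].
    intros n; cbv beta.
    match goal with |- plus ?u ?v = _ => change (u + v = - (sum_f_R0 (fun k => a k * b (n - k)%nat) n * sin (INR n * x))) end.
    rewrite <- plus_sum.
    transitivity ((- sin (INR n * x)) * sum_f_R0 (fun k => a k * b (n - k)%nat) n); [|ring].
    rewrite scal_sum; apply sum_eq; intros i Hi.
    replace (INR n * x) with (INR i * x + INR (n - i) * x) by (rewrite minus_INR by lia; ring).
    rewrite sin_plus; ring.
Qed.

Lemma trig_minus (a b : nat -> R) x :
  ex_series (fun k => Rabs (a k)) -> ex_series (fun k => Rabs (b k)) ->
  trig (fun k => a k - b k) x = (trig a x - trig b x)%C.
Proof.
  intros Ha Hb; unfold trig, Cminus, Cplus, Copp; simpl fst; simpl snd; f_equal.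
  - change (Series (fun k => (a k - b k) * cos (INR k * x)) =
      Series (fun k => a k * cos (INR k * x)) - Series (fun k => b k * cos (INR k * x))).
    rewrite <- Series_minus; [apply Series_ext; intros; ring| |];
      eapply ex_series_dom'; try apply trig_re_le; assumption.
  - change (Series (fun k => - ((a k - b k) * sin (INR k * x))) =
      Series (fun k => - (a k * sin (INR k * x))) - Series (fun k => - (b k * sin (INR k * x)))).
    rewrite <- Series_minus; [apply Series_ext; intros; ring| |];
      eapply ex_series_dom'; try apply trig_im_le; assumption.
Qed.

Lemma trig_scal (a : nat -> R) (c x : R) : trig (fun k => c * a k) x = (RtoC c * trig a x)%C.
Proof.
  unfold trig, Cmult, RtoC; simpl fst; simpl snd; f_equal.
  - rewrite Rmult_0_l, Rminus_0_r, <- Series_scal_l; apply Series_ext; intros; ring.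
  - rewrite Rmult_0_l, Rplus_0_r, <- Series_scal_l; apply Series_ext; intros; ring.
Qed.

Lemma trig_at_0 (a : nat -> R) : trig a 0 = RtoC (Series a).
Proof.
  unfold trig, RtoC; f_equal.
  - apply Series_ext; intros k; rewrite Rmult_0_r, cos_0; ring.
  - rewrite <- (Series_ext (fun _ => 0 * 0)).
    + rewrite Series_scal_l; ring.
    + intros k; rewrite (Rmult_0_r (INR k)), sin_0; ring.
Qed.

Lemma probZp_series F : probZp F ->
  ex_series (fun k => Rabs (F (Z.of_nat k))) /\ Series (fun k => F (Z.of_nat k)) = 1.
Proof.
  intros [H01 [_ Hs]]; split; [|now apply is_series_unique].
  exists 1; eapply is_series_ext; [|exact Hs].
  intros k; cbv beta; rewrite Rabs_pos_eq; [reflexivity|apply H01].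
Qed.

Lemma Fhat_at_0 F : probZp F -> Fhat F 0 = RtoC 1.
Proof.
  intros HF; destruct (probZp_series F HF) as [_ Hs].
  change (Fhat F) with (trig (fun k => F (Z.of_nat k))); now rewrite trig_at_0, Hs.
Qed.

Lemma convpow_S F n k :
  convpow F (S n) (Z.of_nat k) =
    sum_f_R0 (fun j => F (Z.of_nat j) * convpow F n (Z.of_nat (k - j))) k.
Proof.
  simpl convpow; unfold convZp.
  replace (Z.of_nat k <? 0)%Z with false by (symmetry; apply Z.ltb_ge; lia).
  rewrite Nat2Z.id; apply sum_eq; intros i Hi; now rewrite Nat2Z.inj_sub.
Qed.

Lemma is_series_head (u : nat -> R) : (forall k, u (S k) = 0) -> is_series u (u 0%nat).
Proof.
  intros Hu; apply is_series_Reals; intros e He; exists 0%nat; intros m _.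
  replace (sum_f_R0 u m) with (u 0%nat).
  - unfold Rdist; rewrite Rminus_diag, Rabs_R0; exact He.
  - induction m as [|m IH]; [reflexivity|rewrite tech5, <- IH, Hu; ring].
Qed.

Lemma convpow_mass F : probZp F -> forall n,
  (forall k, 0 <= convpow F n (Z.of_nat k)) /\
  is_series (fun k => convpow F n (Z.of_nat k)) 1.
Proof.
  intros HF; destruct (probZp_series F HF) as [HFa _]; destruct HF as [H01 [_ HFs]].
  induction n as [|n [IHpos IHs]].
  - split.
    + intros k; simpl; unfold deltaZ; destruct (Z.eqb _ _); lra.
    + apply (is_series_head (fun k => convpow F 0 (Z.of_nat k))); intros k; reflexivity.
  - split.
    + intros k; rewrite convpow_S; apply cond_pos_sum; intros j.
      apply Rmult_le_pos; [apply H01|apply IHpos].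
    + eapply is_series_ext; [intros k; symmetry; apply convpow_S|].
      rewrite <- (Rmult_1_l 1); apply (is_series_mult (fun j => F (Z.of_nat j)) (fun j => convpow F n (Z.of_nat j))); try assumption.
      exists 1; eapply is_series_ext; [|exact IHs].
      intros k; cbv beta; rewrite Rabs_pos_eq; [reflexivity|apply IHpos].
Qed.

Lemma convpow_abs F n : probZp F -> ex_series (fun k => Rabs (convpow F n (Z.of_nat k))).
Proof.
  intros HF; destruct (convpow_mass F HF n) as [Hpos Hs].
  exists 1; eapply is_series_ext; [|exact Hs].
  intros k; cbv beta; rewrite Rabs_pos_eq; [reflexivity|apply Hpos].
Qed.

Lemma trig_convpow F n x : probZp F ->
  trig (fun k => convpow F n (Z.of_nat k)) x = (Fhat F x ^ n)%C.
Proof.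
  intros HF; induction n as [|n IH].
  - unfold trig; simpl Cpow; unfold RtoC; f_equal; apply is_series_unique.
    + replace 1 with (convpow F 0 (Z.of_nat 0) * cos (INR 0 * x)) at 1.
      * apply (is_series_head (fun k => convpow F 0 (Z.of_nat k) * cos (INR k * x))).
        intros k; change (convpow F 0 (Z.of_nat (S k))) with 0; ring.
      * simpl; rewrite Rmult_0_l, cos_0; unfold deltaZ; simpl; ring.
    + replace 0 with (- (convpow F 0 (Z.of_nat 0) * sin (INR 0 * x))).
      * apply (is_series_head (fun k => - (convpow F 0 (Z.of_nat k) * sin (INR k * x)))).
        intros k; change (convpow F 0 (Z.of_nat (S k))) with 0; ring.
      * simpl; rewrite Rmult_0_l, sin_0; ring.
  - change (Fhat F x ^ S n)%C with (Fhat F x * Fhat F x ^ n)%C; rewrite <- IH.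
    change (Fhat F x) with (trig (fun k => F (Z.of_nat k)) x).
    rewrite <- trig_cauchy; [|apply (probZp_series F HF)|now apply convpow_abs].
    unfold trig; f_equal; apply Series_ext; intros k; now rewrite convpow_S.
Qed.

(* Equality in the triangle inequality forces every k in the support to satisfy
   e^(-ikx) = Fhat F x, so that all differences of support points lie in the
   subgroup {z : cos (z x) = 1}. *)
Lemma Cmod_Fhat_lt_1 F x : probZp F -> aperiodic F -> 0 < x < 2 * PI -> Cmod (Fhat F x) < 1.
Proof.
  intros HF Hap Hx.
  destruct (probZp_series F HF) as [HFa HF1].
  destruct HF as [H01 [Hneg HFs]].
  set (f := fun k => F (Z.of_nat k)) in *.
  change (Fhat F x) with (trig f x).
  set (p := fst (trig f x)); set (q := snd (trig f x)).
  assert (Hexc : ex_series (fun k => f k * cos (INR k * x))) by apply (ex_series_dom' _ _ (trig_re_le f x) HFa).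
  assert (Hexs : ex_series (fun k => - (f k * sin (INR k * x)))) by apply (ex_series_dom' _ _ (trig_im_le f x) HFa).
  assert (Hmod : Cmod (trig f x) ^ 2 = p^2 + q^2).
  { unfold Cmod; rewrite pow2_sqrt; [reflexivity|]; apply Rplus_le_le_0_compat; apply pow2_ge_0. }
  (* With f^ = p + iq this is the variance identity: the sum of f_k |f^ - e^(-ikx)|^2 equals 1 -
     |f^|^2. If |f^| >= 1, every one of these nonnegative terms vanishes. *)
  assert (Hpq : is_series (fun k => f k * (p^2 + q^2 + 1 - 2 * (p * cos (INR k * x) - q * sin (INR k * x))))
                  (1 - (p^2 + q^2))).
  { replace (1 - (p^2 + q^2)) with ((p^2 + q^2 + 1) * 1 + ((-2 * p) * p + (-2 * q) * q)) by ring.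
    eapply is_series_ext; [|apply (is_series_plus (fun k => (p^2 + q^2 + 1) * f k)
       (fun k => -2 * p * (f k * cos (INR k * x)) + -2 * q * - (f k * sin (INR k * x))))].
    - intros k; cbv beta.
      match goal with |- plus ?u ?v = ?w => change (u + v = w) end; ring.
    - apply (is_series_scal_l (p^2 + q^2 + 1) f 1 HFs).
    - apply (is_series_plus (fun k => -2 * p * (f k * cos (INR k * x))) (fun k => -2 * q * - (f k * sin (INR k * x)))).
      + apply (is_series_scal_l (-2 * p) (fun k => f k * cos (INR k * x)) p), Series_correct, Hexc.
      + apply (is_series_scal_l (-2 * q) (fun k => - (f k * sin (INR k * x))) q), Series_correct, Hexs. }
  assert (Hsq : forall k, p^2 + q^2 + 1 - 2 * (p * cos (INR k * x) - q * sin (INR k * x)) =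
            (p - cos (INR k * x))^2 + (q + sin (INR k * x))^2).
  { intros k; assert (H := sin2_cos2 (INR k * x)); unfold Rsqr in H; nra. }
  assert (Hnn : forall k, 0 <= f k * (p^2 + q^2 + 1 - 2 * (p * cos (INR k * x) - q * sin (INR k * x)))).
  { intros k; rewrite Hsq; apply Rmult_le_pos; [apply H01|]; apply Rplus_le_le_0_compat; apply pow2_ge_0. }
  assert (Hge : 1 <= Cmod (trig f x) -> False); [|destruct (Rlt_le_dec (Cmod (trig f x)) 1); tauto].
  intros Hge; assert (H1 : 1 <= p^2 + q^2) by (rewrite <- Hmod; nra).
  assert (Hsupp : forall k, f k <> 0 -> cos (INR k * x) = p /\ sin (INR k * x) = - q).
  { intros k Hk.
    assert (Hk0 : f k * (p^2 + q^2 + 1 - 2 * (p * cos (INR k * x) - q * sin (INR k * x))) <= 0).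
    { apply Rle_trans with (1 - (p^2 + q^2)); [|lra].
      rewrite <- (is_series_unique _ _ Hpq).
      eapply Rle_trans; [|apply (sum_f_R0_le_Series _ k Hnn); now exists (1 - (p^2 + q^2))].
      destruct k as [|k]; [simpl; lra|]; rewrite tech5.
      assert (H := cond_pos_sum _ k Hnn); lra. }
    rewrite Hsq in Hk0.
    assert (0 < f k) by (assert (H := proj1 (H01 (Z.of_nat k))); unfold f in *; lra).
    assert (A1 := pow2_ge_0 (p - cos (INR k * x))); assert (A2 := pow2_ge_0 (q + sin (INR k * x))).
    assert (E1 : (p - cos (INR k * x))^2 = 0) by nra.
    assert (E2 : (q + sin (INR k * x))^2 = 0) by nra.
    assert (F1 : p - cos (INR k * x) = 0) by (apply Rsqr_0_uniq; unfold Rsqr; nra).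
    assert (F2 : q + sin (INR k * x) = 0) by (apply Rsqr_0_uniq; unfold Rsqr; nra).
    lra. }
  assert (Hex : exists k0, f k0 <> 0).
  { apply Classical_Prop.NNPP; intros Hno.
    assert (Hz : forall k, f k = 0) by (intros k; destruct (Req_dec (f k) 0); [assumption|exfalso; eauto]).
    rewrite (Series_ext f (fun _ => 0 * 0)) in HF1 by (intros; rewrite Hz; ring).
    rewrite Series_scal_l in HF1; lra. }
  destruct Hex as [k0 Hk0].
  assert (Hsin : forall y, cos y = 1 -> sin y = 0).
  { intros y Hy; apply Rsqr_0_uniq; assert (H := sin2_cos2 y); rewrite Hy in H; unfold Rsqr in *; lra. }
  assert (Hone : cos (IZR 1 * x) = 1).
  { apply (Hap (- Z.of_nat k0)%Z (fun z => cos (IZR z * x) = 1)).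
    - repeat split.
      + rewrite Rmult_0_l; apply cos_0.
      + intros y z Hy Hz; rewrite plus_IZR, Rmult_plus_distr_r, cos_plus, Hy, Hz, (Hsin _ Hy); ring.
      + intros y Hy; rewrite opp_IZR, Ropp_mult_distr_l_reverse, cos_neg; exact Hy.
    - intros k Hk; unfold translate in Hk.
      destruct (Z_lt_le_dec (k - - Z.of_nat k0) 0) as [Hlt|Hle]; [now rewrite Hneg in Hk|].
      destruct (Z_of_nat_complete _ Hle) as [m Hm].
      rewrite Hm in Hk; destruct (Hsupp m Hk) as [Hc Hs], (Hsupp k0 Hk0) as [Hc0 Hs0].
      replace k with (Z.of_nat m - Z.of_nat k0)%Z by lia.
      rewrite minus_IZR, <- !INR_IZR_INZ, Rmult_minus_distr_r, cos_minus, Hc, Hs, Hc0, Hs0.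
      assert (H := sin2_cos2 (INR k0 * x)); rewrite Hs0, Hc0 in H; unfold Rsqr in H; lra. }
  rewrite Rmult_1_l in Hone.
  destruct (Rle_lt_dec x PI) as [Hle|Hgt].
  - assert (cos x < cos 0) by (apply cos_decreasing_1; lra). rewrite cos_0 in H; lra.
  - assert (cos x < cos (2 * PI)) by (apply cos_increasing_1; lra). rewrite cos_2PI in H; lra.
Qed.

(** * Limits and derivatives of series depending on a parameter *)

Lemma tannery (u : nat -> R -> R) (b : nat -> R) :
  ex_series b -> (forall k t, t <> 0 -> Rabs (u k t) <= b k) ->
  (forall k e, 0 < e -> exists d, 0 < d /\ forall t, t <> 0 -> Rabs t < d -> Rabs (u k t) < e) ->
  forall e, 0 < e -> exists d, 0 < d /\
    forall t, t <> 0 -> Rabs t < d -> Rabs (Series (fun k => u k t)) < e.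
Proof.
  intros Hb Hub Hlim e He.
  (* Dominated convergence: the tail is small uniformly in t, which leaves finitely many limits. *)
  destruct (Series_tail_unif b Hb (e / 4) ltac:(lra)) as [K HK].
  specialize (HK K (le_n K)).
  assert (Hfin : exists d, 0 < d /\ forall t, t <> 0 -> Rabs t < d ->
            Rabs (sum_f_R0 (fun k => u k t) K) < e / 2).
  { clear HK; assert (He2 : 0 < e / 2) by lra; revert He2; generalize (e / 2).
    induction K as [|K IH]; intros e' He'.
    - apply (Hlim 0%nat e' He').
    - destruct (IH (e' / 2) ltac:(lra)) as [d1 [Hd1 H1]].
      destruct (Hlim (S K) (e' / 2) ltac:(lra)) as [d2 [Hd2 H2]].
      exists (Rmin d1 d2); split; [now apply Rmin_pos|].
      intros t Ht0 Ht; rewrite tech5.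
      specialize (H1 t Ht0 (Rlt_le_trans _ _ _ Ht (Rmin_l _ _))).
      specialize (H2 t Ht0 (Rlt_le_trans _ _ _ Ht (Rmin_r _ _))).
      eapply Rle_lt_trans; [apply Rabs_triang|lra]. }
  destruct Hfin as [d [Hd Hfin]]; exists d; split; [exact Hd|].
  intros t Ht0 Ht; specialize (Hfin t Ht0 Ht).
  specialize (HK (fun k => u k t) (fun k => Hub k t Ht0)).
  apply Rabs_def2 in Hfin; apply Rabs_le_between in HK; apply Rabs_def1; lra.
Qed.

(** By the mean value theorem each difference quotient is at most b_k, so its distance to the
    derivative is dominated by 2 b_k and [tannery] applies. The exclusion of t = 0 there is made for
    such quotients. *)
Lemma is_derive_Series (phi phi' : nat -> R -> R) (b : nat -> R) (x : R) :
  (forall k y, is_derive (phi k) y (phi' k y)) ->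
  (forall k y, Rabs (phi' k y) <= b k) -> ex_series b ->
  (forall y, ex_series (fun k => phi k y)) ->
  is_derive (fun y => Series (fun k => phi k y)) x (Series (fun k => phi' k x)).
Proof.
  intros Hd Hb Hexb Hex; apply is_derive_Reals; intros e He.
  assert (Hex' : ex_series (fun k => phi' k x)) by (apply (ex_series_dom' _ b); auto).
  destruct (tannery (fun k t => (phi k (x + t) - phi k x) / t - phi' k x) (fun k => 2 * b k))
    with (e := e) as [d [Hdpos Htan]].
  - exact (ex_series_scal_l 2 _ Hexb).
  - intros k t Ht.
    assert (Hq : Rabs ((phi k (x + t) - phi k x) / t) <= b k).
    { destruct (MVT_gen (phi k) x (x + t) (phi' k)) as [c [_ ->]].
      - intros y _; apply Hd.
      - intros y _; apply continuity_pt_filterlim.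
        apply (ex_derive_continuous (V := R_NormedModule)); eexists; apply Hd.
      - replace (phi' k c * (x + t - x) / t) with (phi' k c) by (field; exact Ht); apply Hb. }
    specialize (Hb k x); unfold Rminus at 1; eapply Rle_trans; [apply Rabs_triang|].
    rewrite Rabs_Ropp; lra.
  - intros k e' He'; specialize (Hd k x); apply is_derive_Reals in Hd.
    destruct (Hd e' He') as [dk Hdk]; exists dk; split; [apply cond_pos|].
    intros t Ht0 Ht; now apply Hdk.
  - exact He.
  - exists (mkposreal d Hdpos); intros t Ht0 Ht; specialize (Htan t Ht0 Ht).
    replace ((Series (fun k => phi k (x + t)) - Series (fun k => phi k x)) / t - Series (fun k => phi' k x))
      with (Series (fun k => (phi k (x + t) - phi k x) / t - phi' k x)); [exact Htan|].
    rewrite Series_minus; [|unfold Rdiv; apply (ex_series_scal_r (/ t) (fun k => phi k (x + t) - phi k x)), (ex_series_minus _ _ (Hex (x + t)) (Hex x))|exact Hex'].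
    unfold Rdiv; rewrite Series_scal_r, Series_minus; auto.
Qed.

(** The derivative bound of [hypI] excludes the point 0; continuity there links the values at x > 0
    to the value 1 at 0. *)
Lemma trig_continuous_at_0 (a : nat -> R) : ex_series (fun k => Rabs (a k)) ->
  forall e, 0 < e -> exists d, 0 < d /\
    forall t, t <> 0 -> Rabs t < d -> Cmod (trig a 0 - trig a t) < e.
Proof.
  intros Ha e He.
  assert (Hcont : forall g : R -> R, (forall y, Rabs (g y) <= 1) -> continuity g ->
    exists d, 0 < d /\ forall t, t <> 0 -> Rabs t < d ->
      Rabs (Series (fun k => a k * (g (INR k * 0) - g (INR k * t)))) < e / 2).
  { intros g Hg Hc.
    apply (tannery (fun k t => a k * (g (INR k * 0) - g (INR k * t))) (fun k => 2 * Rabs (a k))); [exact (ex_series_scal_l 2 _ Ha)| | |lra].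
    - intros k t _; rewrite Rabs_mult, Rmult_comm; apply Rmult_le_compat_r; [apply Rabs_pos|].
      unfold Rminus; eapply Rle_trans; [apply Rabs_triang|]; rewrite Rabs_Ropp.
      assert (H1 := Hg (INR k * 0)); assert (H2 := Hg (INR k * t)); lra.
    - intros k e' He'.
      assert (Hck : continuity_pt (fun t => a k * (g (INR k * 0) - g (INR k * t))) 0).
      { apply continuity_pt_mult; [apply continuity_pt_const; intros ??; reflexivity|].
        apply continuity_pt_minus; [apply continuity_pt_const; intros ??; reflexivity|].
        apply (continuity_pt_comp (fun t => INR k * t) g); [|apply Hc].
        apply derivable_continuous_pt; reg. }
      destruct (Hck e' He') as [d [Hd H]]; exists d; split; [exact Hd|].
      intros t Ht0 Ht; specialize (H t); simpl in H; unfold Rdist in H.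
      rewrite (Rminus_0_r t), Rminus_diag, (Rmult_0_r (a k)), Rminus_0_r in H.
      apply H; split; [split; [exact I|auto]|exact Ht]. }
  destruct (Hcont cos Rabs_cos_le1 continuity_cos) as [d1 [Hd1 H1]].
  destruct (Hcont sin Rabs_sin_le1 continuity_sin) as [d2 [Hd2 H2]].
  exists (Rmin d1 d2); split; [now apply Rmin_pos|]; intros t Ht0 Ht.
  specialize (H1 t Ht0 (Rlt_le_trans _ _ _ Ht (Rmin_l _ _))).
  specialize (H2 t Ht0 (Rlt_le_trans _ _ _ Ht (Rmin_r _ _))).
  eapply Rle_lt_trans; [apply Cmod_le_abs|].
  replace (fst (trig a 0 - trig a t)%C) with (Series (fun k => a k * (cos (INR k * 0) - cos (INR k * t)))).
  - replace (snd (trig a 0 - trig a t)%C) with (- Series (fun k => a k * (sin (INR k * 0) - sin (INR k * t)))).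
    + rewrite Rabs_Ropp; lra.
    + change (snd (trig a 0 - trig a t)%C) with (snd (trig a 0) - snd (trig a t)).
      unfold trig; simpl snd.
      rewrite <- Series_opp, <- Series_minus; [apply Series_ext; intros; ring| |];
        eapply ex_series_dom'; try apply trig_im_le; assumption.
  - change (fst (trig a 0 - trig a t)%C) with (fst (trig a 0) - fst (trig a t)).
    unfold trig; simpl fst.
    rewrite <- Series_minus; [apply Series_ext; intros; ring| |];
      eapply ex_series_dom'; try apply trig_re_le; assumption.
Qed.

Lemma is_derive_Cmult (f g : R -> C) (x : R) (df dg : C) :
  is_derive f x df -> is_derive g x dg ->
  is_derive (fun t => f t * g t)%C x (df * g x + f x * dg)%C.
Proof.
  intros Hf Hg.
  assert (f1 := is_derive_re f x df Hf); assert (f2 := is_derive_im f x df Hf).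
  assert (g1 := is_derive_re g x dg Hg); assert (g2 := is_derive_im g x dg Hg).
  assert (Hm : forall u v du dv, is_derive u x du -> is_derive v x dv ->
            is_derive (fun t => u t * v t) x (du * v x + u x * dv)).
  { intros u v du dv Hu Hv; apply is_derive_Reals; apply is_derive_Reals in Hu; apply is_derive_Reals in Hv.
    now apply derivable_pt_lim_mult. }
  apply is_derive_C; unfold Cplus, Cmult; simpl fst; simpl snd.
  - match goal with |- is_derive _ _ ?r =>
      replace r with (minus (fst df * fst (g x) + fst (f x) * fst dg) (snd df * snd (g x) + snd (f x) * snd dg)) end.
    + apply (is_derive_minus (fun t => fst (f t) * fst (g t)) (fun t => snd (f t) * snd (g t))); now apply Hm.
    + unfold minus, plus, opp; simpl; ring.
  - match goal with |- is_derive _ _ ?r =>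
      replace r with (plus (fst df * snd (g x) + fst (f x) * snd dg) (snd df * fst (g x) + snd (f x) * fst dg)) end.
    + apply (is_derive_plus (fun t => fst (f t) * snd (g t)) (fun t => snd (f t) * fst (g t))); now apply Hm.
    + unfold plus; simpl; ring.
Qed.

Lemma is_derive_Cpow (f : R -> C) (x : R) (df : C) n : is_derive f x df ->
  exists d, is_derive (fun t => f t ^ n)%C x d /\
    Cmod d <= INR n * Cmod (f x) ^ (n - 1) * Cmod df.
Proof.
  intros Hf; induction n as [|n [d [Hd Hle]]].
  - exists (RtoC 0); split.
    + exact (@is_derive_const R_AbsRing C_R_NormedModule (RtoC 1) x).
    + rewrite Cmod_0; simpl; lra.
  - eexists; split.
    + apply (is_derive_Cmult f (fun t => f t ^ n)%C x df d Hf Hd).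
    + eapply Rle_trans; [apply Cmod_triangle|]; rewrite !Cmod_mult, Cmod_pow.
      assert (Hf0 := Cmod_ge_0 (f x)).
      assert (H := Rmult_le_compat_l _ _ _ Hf0 Hle).
      replace (S n - 1)%nat with n by lia; rewrite S_INR.
      destruct n as [|n]; [simpl in *; lra|].
      replace (S n - 1)%nat with n in * by lia; simpl pow in *; nra.
Qed.

(** * Estimates for powers of the transform *)

Lemma trig_periodic (a : nat -> R) x : trig a (x - 2 * PI) = trig a x.
Proof.
  unfold trig; f_equal; apply Series_ext; intros k;
    replace (INR k * x) with (INR k * (x - 2 * PI) + 2 * INR k * PI) by ring.
  - now rewrite cos_period.
  - now rewrite sin_period.
Qed.

Lemma Rpower_minus_1 x y : 0 < x -> Rpower x (y - 1) = Rpower x y / x.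
Proof.
  intros Hx; unfold Rminus, Rdiv; rewrite Rpower_plus, Rpower_Ropp, Rpower_1 by exact Hx; reflexivity.
Qed.

Lemma is_derive_Rpower y x : 0 < x -> is_derive (fun t => Rpower t y) x (y * (Rpower x y / x)).
Proof.
  intros Hx; rewrite <- Rpower_minus_1 by exact Hx.
  apply is_derive_Reals, derivable_pt_lim_power; exact Hx.
Qed.

(** Both g - f and g + f are nondecreasing. Comparison with a primitive g is needed since
    x^(alpha-1) is unbounded near 0: a constant bound on the derivative would not give the order
    x^alpha. *)
Lemma mvt_compare (f g g' : R -> R) x y : x <= y ->
  (forall z, x <= z <= y -> exists d, is_derive f z d /\ Rabs d <= g' z) ->
  (forall z, x <= z <= y -> is_derive g z (g' z)) ->
  Rabs (f y - f x) <= g y - g x.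
Proof.
  intros Hxy Hf Hg.
  assert (Hincr : forall s, s = 1 \/ s = -1 -> s * (f y - f x) <= g y - g x).
  { intros s Hs.
    assert (Hd : forall z, x <= z <= y -> is_derive (fun t => g t - s * f t) z (g' z - s * Derive f z)).
    { intros z Hz; destruct (Hf z Hz) as [d [Hd _]].
      rewrite (is_derive_unique _ _ _ Hd).
      apply (is_derive_minus g (fun t => s * f t) z _ _ (Hg z Hz)).
      apply (is_derive_scal f z s d Hd). }
    destruct (MVT_gen (fun t => g t - s * f t) x y (fun z => g' z - s * Derive f z)) as [c [Hc Heq]].
    - intros z Hz; rewrite Rmin_left, Rmax_right in Hz by lra; apply Hd; lra.
    - intros z Hz; rewrite Rmin_left, Rmax_right in Hz by lra; apply continuity_pt_filterlim.
      apply (ex_derive_continuous (V := R_NormedModule) (fun t => g t - s * f t)); eexists; exact (Hd z Hz).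
    - rewrite Rmin_left, Rmax_right in Hc by lra.
      destruct (Hf c Hc) as [d [Hdc Hle]]; rewrite (is_derive_unique _ _ _ Hdc) in Heq.
      apply Rabs_le_between in Hle.
      assert (0 <= (g' c - s * d) * (y - x)) by (apply Rmult_le_pos; [destruct Hs as [-> | ->]|]; lra).
      lra. }
  assert (H1 := Hincr 1 ltac:(auto)); assert (H2 := Hincr (-1) ltac:(auto)).
  apply Rabs_le; lra.
Qed.

Section Estimates.

Variables (alpha eps c : R) (F : Z -> R).
Hypothesis Halpha : 0 < alpha < 1.
Hypothesis HF : probZp F.
Hypothesis Hap : aperiodic F.
Hypothesis Heps : 0 < eps < 1.
Hypothesis Hc : 0 < c.
Hypothesis Hre : forall xi, - eps <= xi <= eps -> 1 - fst (Fhat F xi) >= eps * powabs xi alpha.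
Hypothesis Hder : forall xi, - PI <= xi <= PI -> xi <> 0 ->
  exists d : C, is_derive (Fhat F) xi d /\ Cmod d <= c * Rpower (Rabs xi) (alpha - 1).

(** Beyond pi the bound is taken at x - 2 pi. There 2 pi - x >= pi/2 >= x/3, and 3^(1-alpha) <= 3
    accounts for the factor 3. *)
Lemma Fhat_derivative x : 0 < x <= 3 * PI / 2 ->
  exists d : C, is_derive (Fhat F) x d /\ Cmod d <= 3 * c * (Rpower x alpha / x).
Proof.
  intros Hx; assert (HPI := PI_RGT_0).
  rewrite <- Rpower_minus_1 by lra.
  assert (Hp := Rpower_pos x (alpha - 1)).
  assert (Hcp : 0 < c * Rpower x (alpha - 1)) by nra.
  destruct (Rle_lt_dec x PI) as [Hle|Hgt].
  - destruct (Hder x ltac:(lra) ltac:(lra)) as [d [Hd Hdle]]; exists d; split; [exact Hd|].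
    rewrite Rabs_pos_eq in Hdle by lra; lra.
  - destruct (Hder (x - 2 * PI) ltac:(lra) ltac:(lra)) as [d [Hd Hdle]]; exists d; split.
    + apply (is_derive_ext (fun t => Fhat F (t - 2 * PI))).
      { intros t; apply (trig_periodic (fun k => F (Z.of_nat k))). }
      replace d with (scal 1 d) by apply (@scal_one R_AbsRing C_R_NormedModule).
      apply (is_derive_comp (Fhat F) (fun t => t - 2 * PI) x d 1 Hd).
      auto_derive; [trivial|ring].
    + eapply Rle_trans; [exact Hdle|].
      rewrite Rabs_left by lra.
      assert (H1 : Rpower (- (x - 2 * PI)) (alpha - 1) <= Rpower (/ 3 * x) (alpha - 1)).
      { replace (alpha - 1) with (- (1 - alpha)) by ring; apply Rpower_neg_le; lra. }
      rewrite <- Rpower_mult_distr in H1 by lra.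
      assert (H2 : Rpower (/ 3) (alpha - 1) <= 3).
      { replace (alpha - 1) with (- (1 - alpha)) by ring.
        unfold Rpower; rewrite ln_Rinv by lra.
        replace (- (1 - alpha) * - ln 3) with ((1 - alpha) * ln 3) by ring.
        apply (Rpower_le_id 3 (1 - alpha)); lra. }
      nra.
Qed.

(** A primitive of 3c x^(alpha-1) is (3c/alpha) x^alpha; the 2 is for the real and imaginary
    parts. *)
Definition near_1_const := 2 * (3 * c / alpha).

Lemma near_1_const_pos : 0 < near_1_const.
Proof. unfold near_1_const; assert (0 < 3 * c / alpha) by (apply Rdiv_lt_0_compat; lra); lra. Qed.

(** The derivative bound is integrated from a point y > 0 up to x. Continuity at 0 makes the
    remaining piece 1 - f(y) smaller than any e. *)
Lemma Fhat_near_1 x : 0 < x <= 3 * PI / 2 -> Cmod (1 - Fhat F x) <= near_1_const * Rpower x alpha.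
Proof.
  intros Hx.
  assert (Hc3 : 0 < 3 * c / alpha) by (apply Rdiv_lt_0_compat; lra).
  apply le_epsilon; intros e He.
  destruct (trig_continuous_at_0 (fun k => F (Z.of_nat k)) (proj1 (probZp_series F HF)) e He) as [d [Hd Hcont]].
  change (trig (fun k => F (Z.of_nat k))) with (Fhat F) in Hcont; rewrite (Fhat_at_0 F HF) in Hcont.
  set (y := Rmin (x / 2) (d / 2)).
  assert (Hy : 0 < y /\ y <= x / 2 /\ y <= d / 2).
  { unfold y; repeat split; [apply Rmin_pos; lra|apply Rmin_l|apply Rmin_r]. }
  specialize (Hcont y ltac:(lra) ltac:(rewrite Rabs_pos_eq; lra)).
  set (g := fun t => 3 * c / alpha * Rpower t alpha).
  set (g' := fun t => 3 * c * (Rpower t alpha / t)).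
  assert (Hg : forall z, y <= z <= x -> is_derive g z (g' z)).
  { intros z Hz; unfold g, g'.
    replace (3 * c * (Rpower z alpha / z)) with (3 * c / alpha * (alpha * (Rpower z alpha / z))) by (field; lra).
    apply (is_derive_scal (fun t => Rpower t alpha)), is_derive_Rpower; lra. }
  assert (H1 : Rabs (fst (Fhat F x) - fst (Fhat F y)) <= g x - g y).
  { apply (mvt_compare (fun t => fst (Fhat F t)) g g'); [lra| |exact Hg].
    intros z Hz; destruct (Fhat_derivative z ltac:(lra)) as [dz [Hdz Hle]]; exists (fst dz); split;
      [now apply is_derive_re|eapply Rle_trans; [apply Cmod_re_le|exact Hle]]. }
  assert (H2 : Rabs (snd (Fhat F x) - snd (Fhat F y)) <= g x - g y).
  { apply (mvt_compare (fun t => snd (Fhat F t)) g g'); [lra| |exact Hg].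
    intros z Hz; destruct (Fhat_derivative z ltac:(lra)) as [dz [Hdz Hle]]; exists (snd dz); split;
      [now apply is_derive_im|eapply Rle_trans; [apply Cmod_im_le|exact Hle]]. }
  assert (H3 : Cmod (Fhat F y - Fhat F x) <= 2 * g x).
  { eapply Rle_trans; [apply Cmod_le_abs|].
    change (Rabs (fst (Fhat F y) - fst (Fhat F x)) + Rabs (snd (Fhat F y) - snd (Fhat F x)) <= 2 * g x).
    rewrite (Rabs_minus_sym (fst (Fhat F y))), (Rabs_minus_sym (snd (Fhat F y))).
    assert (0 < g y) by (apply Rmult_lt_0_compat; [lra|apply Rpower_pos]); lra. }
  replace (1 - Fhat F x)%C with ((1 - Fhat F y) + (Fhat F y - Fhat F x))%C by ring.
  eapply Rle_trans; [apply Cmod_triangle|].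
  unfold near_1_const, g in *; lra.
Qed.

Lemma Rpower_alpha_le_6 x : 0 < x <= 3 * PI / 2 -> Rpower x alpha <= 6.
Proof.
  intros Hx; assert (HPI := PI_4).
  apply Rle_trans with (Rpower 6 alpha); [apply Rle_Rpower_l; lra|apply Rpower_le_id; lra].
Qed.

Lemma Cmod_sq (z : C) : Cmod z ^ 2 = fst z ^ 2 + snd z ^ 2.
Proof. unfold Cmod; apply pow2_sqrt, Rplus_le_le_0_compat; apply pow2_ge_0. Qed.

Lemma Cmod_le_exp (z : C) l X : 0 <= X -> Cmod z ^ 2 <= exp (- (2 * l) * X) -> Cmod z <= exp (- l * X).
Proof.
  intros HX H; apply Rsqr_incr_0_var; [|left; apply exp_pos].
  unfold Rsqr; rewrite <- exp_plus; simpl in H.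
  replace (- l * X + - l * X) with (- (2 * l) * X) by ring; lra.
Qed.

Lemma exp_neg_antimono k l X : k <= l -> 0 <= X -> exp (- l * X) <= exp (- k * X).
Proof.
  intros Hkl HX; assert (Hle : - l * X <= - k * X) by nra.
  destruct Hle as [Hlt|E]; [left; now apply exp_increasing|rewrite E; lra].
Qed.

(** Let X = x^alpha and C = [near_1_const]. Then |f|^2 = 1 - 2(1 - Re f) + |1 - f|^2 <= 1 - 2 eps X
    + C^2 X^2, which is at most 1 - eps X <= e^(-eps X) as soon as C^2 X <= eps. *)
Lemma Fhat_exp_bound_near_0 : exists x0, 0 < x0 < 1 /\
  forall x, 0 < x <= x0 -> Cmod (Fhat F x) <= exp (- (eps / 2) * Rpower x alpha).
Proof.
  assert (HC := near_1_const_pos).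
  assert (HC2 : 0 < near_1_const ^ 2) by (apply pow_lt; lra).
  (* The point where C^2 r^alpha = eps. *)
  set (r := Rpower (eps / near_1_const ^ 2) (/ alpha)).
  assert (Hr : 0 < r) by apply Rpower_pos.
  assert (Hq : 0 < eps / near_1_const ^ 2) by (apply Rdiv_lt_0_compat; lra).
  exists (Rmin eps r); split.
  { split; [apply Rmin_pos; lra|]; eapply Rle_lt_trans; [apply Rmin_l|lra]. }
  intros x Hx.
  assert (Hxe : x <= eps) by (eapply Rle_trans; [apply Hx|apply Rmin_l]).
  assert (Hxr : x <= r) by (eapply Rle_trans; [apply Hx|apply Rmin_r]).
  set (X := Rpower x alpha).
  assert (HX : 0 < X) by apply Rpower_pos.
  assert (HXr : near_1_const ^ 2 * X <= eps).
  { assert (H : X <= Rpower r alpha) by (apply Rle_Rpower_l; lra).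
    unfold r in H; rewrite Rpower_mult, Rinv_l, Rpower_1 in H by lra.
    apply (Rmult_le_compat_l (near_1_const ^ 2)) in H; [|lra].
    replace (near_1_const ^ 2 * (eps / near_1_const ^ 2)) with eps in H by (field; lra); exact H. }
  assert (HPI := PI2_3_2); unfold PI2 in HPI.
  assert (Hn := Fhat_near_1 x ltac:(lra)).
  assert (Hr1 := Hre x ltac:(lra)).
  unfold powabs in Hr1; destruct (Req_EM_T x 0) as [E|_]; [lra|].
  rewrite Rabs_pos_eq in Hr1 by lra; fold X in Hn, Hr1.
  apply Cmod_le_exp; [lra|].
  assert (Hn2 : Cmod (1 - Fhat F x) ^ 2 <= near_1_const ^ 2 * X ^ 2).
  { rewrite <- Rpow_mult_distr; apply pow_incr; split; [apply Cmod_ge_0|exact Hn]. }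
  rewrite Cmod_sq in Hn2; rewrite Cmod_sq.
  change (fst (1 - Fhat F x)%C) with (1 - fst (Fhat F x)) in Hn2.
  replace (snd (1 - Fhat F x)%C) with (- snd (Fhat F x)) in Hn2
    by (unfold Cminus, Cplus, Copp; simpl; ring).
  apply Rle_trans with (1 + - (2 * (eps / 2)) * X); [|apply exp_ineq1_le].
  assert (H4 : near_1_const ^ 2 * X ^ 2 <= eps * X) by (simpl; nra).
  nra.
Qed.

(** On the compact interval [x0, 3 pi/2], which stays below 2 pi, |f|^2 attains a maximum less than
    1. As x^alpha is bounded there, this constant bound is also an exponential one. *)
Lemma Fhat_exp_bound : exists k, 0 < k /\
  forall x, 0 < x <= 3 * PI / 2 -> Cmod (Fhat F x) <= exp (- k * Rpower x alpha).
Proof.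
  destruct Fhat_exp_bound_near_0 as [x0 [Hx0 Hnear]].
  assert (HPI := PI2_3_2); unfold PI2 in HPI.
  set (f := fun x => fst (Fhat F x) ^ 2 + snd (Fhat F x) ^ 2).
  destruct (continuity_ab_maj f x0 (3 * PI / 2)) as [xm [Hmax Hxm]].
  - lra.
  - intros z Hz; destruct (Fhat_derivative z ltac:(lra)) as [d [Hd _]].
    assert (Hcr : continuity_pt (fun t => fst (Fhat F t)) z).
    { apply continuity_pt_filterlim, (ex_derive_continuous (V := R_NormedModule)).
      eexists; apply (is_derive_re _ _ _ Hd). }
    assert (Hci : continuity_pt (fun t => snd (Fhat F t)) z).
    { apply continuity_pt_filterlim, (ex_derive_continuous (V := R_NormedModule)).
      eexists; apply (is_derive_im _ _ _ Hd). }
    unfold f; simpl.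
    repeat first [apply continuity_pt_plus|apply continuity_pt_mult|assumption
                 |apply continuity_pt_const; intros ? ?; reflexivity].
  - assert (Hm1 : f xm < 1).
    { unfold f; rewrite <- Cmod_sq.
      assert (H := Cmod_Fhat_lt_1 F xm HF Hap ltac:(lra)); assert (H' := Cmod_ge_0 (Fhat F xm)); nra. }
    (* The maximum could be 0; raising it to 1/2 keeps its logarithm meaningful. *)
    set (M := Rmax (f xm) (/ 2)).
    assert (HM : 0 < M < 1).
    { unfold M; split; [eapply Rlt_le_trans; [|apply Rmax_r]; lra|apply Rmax_lub_lt; lra]. }
    set (l := - ln M).
    assert (Hl : 0 < l) by (unfold l; assert (H := ln_increasing M 1 ltac:(lra) ltac:(lra)); rewrite ln_1 in H; lra).
    (* From |f|^2 <= e^(-l) and x^alpha <= 6 follows |f|^2 <= exp(-(l/6) x^alpha); the square root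
       halves the rate to l/12. *)
    exists (Rmin (eps / 2) (l / 12)); split; [apply Rmin_pos; lra|].
    intros x Hx; assert (HX := Rpower_pos x alpha); assert (HX6 := Rpower_alpha_le_6 x Hx).
    destruct (Rle_lt_dec x x0) as [Hle|Hgt].
    + eapply Rle_trans; [apply Hnear; lra|]; apply exp_neg_antimono; [apply Rmin_l|lra].
    + apply Rle_trans with (exp (- (l / 12) * Rpower x alpha)); [|apply exp_neg_antimono; [apply Rmin_r|lra]].
      apply Cmod_le_exp; [lra|].
      rewrite Cmod_sq; fold (f x).
      apply Rle_trans with M.
      * eapply Rle_trans; [apply (Hmax x); lra|apply Rmax_l].
      * rewrite <- (exp_ln M) at 1 by lra.
        replace (ln M) with (- l * 1) by (unfold l; ring).
        replace (- (2 * (l / 12)) * Rpower x alpha) with (- l * (Rpower x alpha / 6)) by field.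
        assert (Hle : - l * 1 <= - l * (Rpower x alpha / 6)) by nra.
        destruct Hle as [Hlt|E]; [left; now apply exp_increasing|rewrite E; lra].
Qed.

(** With t = y^alpha and p = s/alpha the function is t^p e^(-kt). The inequality ln u <= u at u = k
    t/p bounds it by (p/k)^p. *)
Lemma Rpower_exp_bounded k s : 0 < k -> 0 < s ->
  exists M, 0 < M /\ forall y, 0 < y -> Rpower y s * exp (- k * Rpower y alpha) <= M.
Proof.
  intros Hk Hs; set (p := s / alpha).
  assert (Hp : 0 < p) by (apply Rdiv_lt_0_compat; lra).
  exists (exp (p * ln (p / k))); split; [apply exp_pos|]; intros y Hy.
  set (t := Rpower y alpha); assert (Ht : 0 < t) by apply Rpower_pos.
  replace (Rpower y s) with (Rpower t p) by (unfold t, p; rewrite Rpower_mult; f_equal; field; lra).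
  unfold Rpower; rewrite <- exp_plus.
  assert (Hkp : 0 < k / p) by (apply Rdiv_lt_0_compat; lra).
  assert (Hkt : 0 < k / p * t) by nra.
  assert (Hln : ln (k / p * t) <= k / p * t).
  { assert (H := exp_ineq1_le (ln (k / p * t))); rewrite exp_ln in H by exact Hkt; lra. }
  rewrite ln_mult in Hln by lra.
  replace (ln (p / k)) with (- ln (k / p)).
  - apply (Rmult_le_compat_l p) in Hln; [|lra].
    replace (p * (k / p * t)) with (k * t) in Hln by (field; lra).
    assert (Hle : p * ln t + - k * t <= p * - ln (k / p)) by lra.
    destruct Hle as [Hlt|E]; [left; now apply exp_increasing|rewrite E; lra].
  - rewrite <- ln_Rinv by exact Hkp; f_equal; field; lra.
Qed.

Definition convpow_diff (n : nat) : nat -> R :=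
  fun k => convpow F n (Z.of_nat k) - convpow F (S n) (Z.of_nat k).

Lemma convpow_diff_abs n : ex_series (fun k => Rabs (convpow_diff n k)).
Proof.
  apply (ex_series_dom _ (fun k => Rabs (convpow F n (Z.of_nat k)) + Rabs (convpow F (S n) (Z.of_nat k)))).
  - intros k; unfold convpow_diff, Rminus; eapply Rle_trans; [apply Rabs_triang|]; rewrite Rabs_Ropp; lra.
  - apply (ex_series_plus _ _ (convpow_abs F n HF) (convpow_abs F (S n) HF)).
Qed.

Lemma trig_convpow_diff n x : trig (convpow_diff n) x = (Fhat F x ^ n * (1 - Fhat F x))%C.
Proof.
  unfold convpow_diff; rewrite trig_minus; [|now apply convpow_abs..].
  rewrite !trig_convpow by exact HF; simpl Cpow; ring.
Qed.

Lemma is_derive_trig_convpow_diff n (x : R) (df : C) : is_derive (Fhat F) x df ->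
  exists d, is_derive (trig (convpow_diff n)) x d /\
    Cmod d <= (INR n * Cmod (Fhat F x) ^ (n - 1) * Cmod (1 - Fhat F x) + Cmod (Fhat F x) ^ n) * Cmod df.
Proof.
  intros Hdf.
  destruct (is_derive_Cpow (Fhat F) x df n Hdf) as [d [Hd Hle]].
  assert (H1 : is_derive (fun t => 1 - Fhat F t)%C x (- df)%C).
  { replace (- df)%C with (minus (zero : C_R_NormedModule) df) by apply (@plus_zero_l C_R_NormedModule).
    apply (is_derive_minus (V := C_R_NormedModule) (fun _ => RtoC 1) (Fhat F)); [|exact Hdf].
    exact (@is_derive_const R_AbsRing C_R_NormedModule (RtoC 1) x). }
  exists (d * (1 - Fhat F x) + Fhat F x ^ n * - df)%C; split.
  - apply (is_derive_ext (fun t => Fhat F t ^ n * (1 - Fhat F t))%C).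
    + intros t; symmetry; apply trig_convpow_diff.
    + apply (is_derive_Cmult (fun t => Fhat F t ^ n)%C (fun t => 1 - Fhat F t)%C); assumption.
  - eapply Rle_trans; [apply Cmod_triangle|].
    rewrite !Cmod_mult, Cmod_pow, Cmod_opp.
    assert (Hg := Cmod_ge_0 (1 - Fhat F x)).
    apply (Rmult_le_compat_r _ _ _ Hg) in Hle; lra.
Qed.

(** Put y = N x and t = y^alpha = n x^alpha. Then |f|^n <= e^(-kt) and |1 - f| <= C t/n, so each
    estimate reduces, up to the factor 1/n (and 1/x for the derivative), to the boundedness of a
    power of y times e^(-kt). *)
Lemma convpow_diff_estimates : exists B, 0 < B /\ forall n, (0 < n)%nat -> forall x, 0 < x <= 3 * PI / 2 ->
  let N := Rpower (INR n) (/ alpha) in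
  Cmod (trig (convpow_diff n) x) <= B / INR n * Rpower (N * x) (alpha / 2) /\
  Cmod (trig (convpow_diff n) x) <= B / INR n * Rpower (1 + N * x) (- (1 - alpha / 2)) /\
  exists d, is_derive (trig (convpow_diff n)) x d /\ Cmod d <= B / INR n * (Rpower (N * x) (alpha / 2) / x).
Proof.
  destruct Fhat_exp_bound as [k [Hk Hexp]].
  destruct (Rpower_exp_bounded k (alpha / 2) Hk ltac:(lra)) as [M1 [HM1 Hb1]].
  destruct (Rpower_exp_bounded k alpha Hk ltac:(lra)) as [M2 [HM2 Hb2]].
  destruct (Rpower_exp_bounded k (alpha + 1) Hk ltac:(lra)) as [M3 [HM3 Hb3]].
  destruct (Rpower_exp_bounded k (alpha + alpha / 2) Hk ltac:(lra)) as [M4 [HM4 Hb4]].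
  assert (HC := near_1_const_pos).
  (* The derivative of f^n contains f^(n-1); the missing factor of decay costs at most exp(k
     x^alpha) <= exp(6k). *)
  set (E6 := exp (6 * k)).
  assert (HE6 : 0 < E6) by apply exp_pos.
  assert (P1 : 0 < near_1_const * M1) by nra.
  assert (P2 : 0 < near_1_const * (M2 + M3)) by nra.
  assert (P3 : 0 < 3 * c * (near_1_const * E6 * M4 + M1)).
  { assert (0 < near_1_const * E6 * M4) by (apply Rmult_lt_0_compat; nra); nra. }
  exists (near_1_const * M1 + near_1_const * (M2 + M3) + 3 * c * (near_1_const * E6 * M4 + M1)); split; [lra|].
  set (B := near_1_const * M1 + near_1_const * (M2 + M3) + 3 * c * (near_1_const * E6 * M4 + M1)).
  intros n Hn x Hx N.
  assert (Hn' : 0 < INR n) by now apply lt_0_INR.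
  assert (HN : 0 < N) by apply Rpower_pos.
  set (y := N * x); assert (Hy : 0 < y) by (unfold y; nra).
  set (X := Rpower x alpha); assert (HX : 0 < X) by apply Rpower_pos.
  set (t := Rpower y alpha); assert (Ht : 0 < t) by apply Rpower_pos.
  assert (HtX : t = INR n * X).
  { unfold t, y, N; rewrite <- Rpower_mult_distr by (try apply Rpower_pos; lra).
    rewrite Rpower_mult, Rinv_l, Rpower_1 by lra; reflexivity. }
  assert (HXt : X = t / INR n) by (rewrite HtX; field; lra).
  set (e := exp (- k * t)); assert (He : 0 < e) by apply exp_pos.
  specialize (Hb1 y Hy); specialize (Hb2 y Hy); specialize (Hb3 y Hy); specialize (Hb4 y Hy).
  fold t in Hb1, Hb2, Hb3, Hb4; fold e in Hb1, Hb2, Hb3, Hb4.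
  set (w := Rpower y (alpha / 2)) in *; assert (Hw : 0 < w) by apply Rpower_pos.
  assert (Htw : t = w * w) by (unfold t, w; rewrite <- Rpower_plus; f_equal; field).
  rewrite Rpower_plus, Rpower_1 in Hb3 by exact Hy; fold t in Hb3.
  rewrite Rpower_plus in Hb4; fold t w in Hb4.
  assert (Hpow : forall j, Cmod (Fhat F x) ^ j <= exp (- k * (INR j * X))).
  { intros j; eapply Rle_trans; [apply pow_incr; split; [apply Cmod_ge_0|apply Hexp; exact Hx]|].
    fold X; right; induction j as [|j IH].
    - simpl; rewrite Rmult_0_l, Rmult_0_r, exp_0; reflexivity.
    - rewrite S_INR; simpl; rewrite IH, <- exp_plus; f_equal; ring. }
  assert (Hpn : Cmod (Fhat F x) ^ n <= e) by (unfold e; rewrite HtX; apply Hpow).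
  assert (Hpn1 : Cmod (Fhat F x) ^ (n - 1) <= E6 * e).
  { eapply Rle_trans; [apply Hpow|]; unfold E6, e; rewrite <- exp_plus.
    rewrite minus_INR by lia; simpl (INR 1).
    assert (HX6 := Rpower_alpha_le_6 x Hx); fold X in HX6.
    assert (Hle : - k * ((INR n - 1) * X) <= 6 * k + - k * t) by (rewrite HtX; nra).
    destruct Hle as [Hlt|E]; [left; now apply exp_increasing|rewrite E; lra]. }
  assert (Hone := Fhat_near_1 x Hx); fold X in Hone.
  assert (Hh : Cmod (trig (convpow_diff n) x) <= near_1_const / INR n * (t * e)).
  { rewrite trig_convpow_diff, Cmod_mult, Cmod_pow.
    replace (near_1_const / INR n * (t * e)) with (e * (near_1_const * X)) by (rewrite HXt; field; lra).
    apply Rmult_le_compat; [apply pow_le, Cmod_ge_0|apply Cmod_ge_0|exact Hpn|exact Hone]. }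
  assert (Hin : 0 < / INR n) by now apply Rinv_0_lt_compat.
  assert (HB : forall u v, u <= B -> 0 <= v -> u * / INR n * v <= B / INR n * v).
  { intros u v Hu Hv; unfold Rdiv; apply Rmult_le_compat_r; [exact Hv|]; apply Rmult_le_compat_r; lra. }
  split; [|split].
  - eapply Rle_trans; [exact Hh|].
    apply Rle_trans with (near_1_const * M1 * / INR n * w); [|apply HB; unfold B; lra].
    replace (near_1_const / INR n * (t * e)) with (near_1_const * (w * e) * / INR n * w) by (rewrite Htw; field; lra).
    apply Rmult_le_compat_r; [lra|]; apply Rmult_le_compat_r; [lra|]; apply Rmult_le_compat_l; lra.
  - eapply Rle_trans; [exact Hh|].
    set (v := Rpower (1 + y) (- (1 - alpha / 2))); assert (Hv : 0 < v) by apply Rpower_pos.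
    apply Rle_trans with (near_1_const * (M2 + M3) * / INR n * v); [|apply HB; unfold B; lra].
    (* (1 + y) v = (1 + y)^(alpha/2) >= 1, so v may be inserted at the price of a factor 1 + y,
       which the exponential absorbs through M2 and M3. *)
    assert (Hvy : 1 <= (1 + y) * v).
    { unfold v; rewrite <- (Rpower_1 (1 + y)) at 1 by lra; rewrite <- Rpower_plus.
      apply Rpower_ge_1; lra. }
    assert (Hkey : t * e <= (M2 + M3) * v).
    { apply Rle_trans with (t * e * ((1 + y) * v)).
      - rewrite <- (Rmult_1_r (t * e)) at 1; apply Rmult_le_compat_l; [|exact Hvy].
        apply Rlt_le, Rmult_lt_0_compat; lra.
      - replace (t * e * ((1 + y) * v)) with ((t * e + t * y * e) * v) by ring.
        apply Rmult_le_compat_r; lra. }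
    replace (near_1_const * (M2 + M3) * / INR n * v) with (near_1_const / INR n * ((M2 + M3) * v)) by (field; lra).
    apply Rmult_le_compat_l; [apply Rlt_le, Rdiv_lt_0_compat; lra|exact Hkey].
  - destruct (Fhat_derivative x Hx) as [df [Hdf Hdfle]]; fold X in Hdfle.
    destruct (is_derive_trig_convpow_diff n x df Hdf) as [d [Hd Hdle]]; exists d; split; [exact Hd|].
    eapply Rle_trans; [exact Hdle|].
    apply Rle_trans with (3 * c * (near_1_const * E6 * M4 + M1) * / INR n * (w / x));
      [|apply HB; [unfold B; lra|apply Rlt_le, Rdiv_lt_0_compat; lra]].
    (* The factor n from differentiating the power is cancelled by |1 - f| <= C t/n. *)
    assert (Hf1 : INR n * Cmod (Fhat F x) ^ (n - 1) * Cmod (1 - Fhat F x) <= E6 * e * (near_1_const * t)).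
    { replace (E6 * e * (near_1_const * t)) with (INR n * (E6 * e) * (near_1_const * X)) by (rewrite HtX; ring).
      apply Rmult_le_compat; [|apply Cmod_ge_0| |exact Hone].
      - apply Rmult_le_pos; [lra|apply pow_le, Cmod_ge_0].
      - apply Rmult_le_compat_l; [lra|exact Hpn1]. }
    apply Rle_trans with ((E6 * e * (near_1_const * t) + e) * (3 * c * (X / x))).
    + apply Rmult_le_compat; [|apply Cmod_ge_0|lra|exact Hdfle].
      apply Rplus_le_le_0_compat; [|apply pow_le, Cmod_ge_0].
      apply Rmult_le_pos; [apply Rmult_le_pos; [lra|apply pow_le, Cmod_ge_0]|apply Cmod_ge_0].
    + replace ((E6 * e * (near_1_const * t) + e) * (3 * c * (X / x)))
        with (3 * c * (near_1_const * E6 * (t * w * e) + w * e) * / INR n * (w / x))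
        by (rewrite HXt, Htw; field; lra).
      apply Rmult_le_compat_r; [apply Rlt_le, Rdiv_lt_0_compat; lra|].
      apply Rmult_le_compat_r; [lra|].
      apply Rmult_le_compat_l; [lra|].
      apply Rplus_le_compat; [|exact Hb1].
      apply Rmult_le_compat_l; [nra|exact Hb4].
Qed.

(** The Bernstein bound is used with A = B/n and N = n^(1/alpha). Its constant depends on alpha
    alone, so multiplication by n leaves a bound uniform in n. *)
Lemma classA_of_estimates : classA F.
Proof.
  split; [exact HF|].
  destruct convpow_diff_estimates as [B [HB Hest]].
  set (K := block_const (alpha / 2) * (1 + / (1 - Rpower (/ 2) (alpha / 2)))).
  assert (Hbound : forall n, (0 < n)%nat ->
            INR n * Series (fun k => Rabs (convpow_diff n k)) <= K * B).
  { intros n Hn; assert (Hn' : 1 <= INR n) by (apply (le_INR 1); lia).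
    assert (HN : 1 <= Rpower (INR n) (/ alpha)).
    { apply Rpower_ge_1; [lra|]; left; apply Rinv_0_lt_compat; lra. }
    assert (HS : Series (fun k => Rabs (convpow_diff n k)) <= K * (B / INR n)).
    { apply Series_le_bound; [apply convpow_diff_abs|]; intros L; unfold K.
      apply (abs_sum_bound (alpha / 2) (B / INR n) (Rpower (INR n) (/ alpha))).
      - lra.
      - apply Rdiv_lt_0_compat; lra.
      - exact HN.
      - apply convpow_diff_abs.
      - rewrite trig_convpow_diff, (Fhat_at_0 F HF); ring.
      - intros x Hx; apply (Hest n Hn x Hx).
      - intros x Hx; apply (Hest n Hn x Hx).
      - intros x Hx; apply (Hest n Hn x Hx). }
    apply (Rmult_le_compat_l (INR n)) in HS; [|lra].
    replace (INR n * (K * (B / INR n))) with (K * B) in HS by (field; lra); exact HS. }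
  (* The estimates hold for n >= 1; for n = 0 the factor n makes the left side 0. *)
  exists (Rmax 0 (K * B)); intros [|n].
  - simpl INR; rewrite Rmult_0_l; apply Rmax_l.
  - eapply Rle_trans; [apply (Hbound (S n)); lia|apply Rmax_r].
Qed.

End Estimates.

Lemma hypI_classA alpha F : 0 < alpha < 1 -> probZp F -> aperiodic F -> hypI alpha F -> classA F.
Proof.
  intros Halpha HF Hap [eps [c [Heps [Hc [Hre Hder]]]]].
  exact (classA_of_estimates alpha eps c F Halpha HF Hap Heps Hc Hre Hder).
Qed.

(** * Stability of the hypotheses under perturbation *)

Lemma trig_derivative_bounded (a : nat -> R) x :
  ex_series (fun k => Rabs (a k)) -> ex_series (fun k => INR k * Rabs (a k)) ->
  exists d : C, is_derive (trig a) x d /\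
    Rabs (fst d) <= Series (fun k => INR k * Rabs (a k)) /\
    Cmod d <= 2 * Series (fun k => INR k * Rabs (a k)).
Proof.
  intros Ha Hka.
  set (dc := fun k y => - (INR k * a k * sin (INR k * y))).
  set (ds := fun k y => - (INR k * a k * cos (INR k * y))).
  assert (Hk : forall k, Rabs (INR k * a k) = INR k * Rabs (a k)).
  { intros k; rewrite Rabs_mult, (Rabs_pos_eq (INR k)) by apply pos_INR; reflexivity. }
  assert (Hdc : forall k y, Rabs (dc k y) <= INR k * Rabs (a k)).
  { intros k y; unfold dc; rewrite Rabs_Ropp, <- Hk; apply Rabs_mul_le_l, Rabs_sin_le1. }
  assert (Hds : forall k y, Rabs (ds k y) <= INR k * Rabs (a k)).
  { intros k y; unfold ds; rewrite Rabs_Ropp, <- Hk; apply Rabs_mul_le_l, Rabs_cos_le1. }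
  assert (Hc := Series_abs_le (fun k => dc k x) _ (fun k => Hdc k x) Hka).
  assert (Hs := Series_abs_le (fun k => ds k x) _ (fun k => Hds k x) Hka).
  exists (Series (fun k => dc k x), Series (fun k => ds k x)); split; [|split].
  - apply is_derive_C; unfold trig; simpl fst; simpl snd.
    + apply (is_derive_Series (fun k y => a k * cos (INR k * y)) dc (fun k => INR k * Rabs (a k)) x).
      * intros k y; unfold dc; auto_derive; [trivial|ring].
      * exact Hdc.
      * exact Hka.
      * intros y; apply (ex_series_dom' _ _ (trig_re_le a y) Ha).
    + apply (is_derive_Series (fun k y => - (a k * sin (INR k * y))) ds (fun k => INR k * Rabs (a k)) x).
      * intros k y; unfold ds; auto_derive; [trivial|ring].
      * exact Hds.
      * exact Hka.
      * intros y; apply (ex_series_dom' _ _ (trig_im_le a y) Ha).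
  - exact Hc.
  - eapply Rle_trans; [apply Cmod_le_abs|]; simpl fst; simpl snd; lra.
Qed.

(** Let D = G - aF. Its transform equals 1 - a at 0 and is Lipschitz, so 1 - Re G^ differs from a (1
    - Re F^) by at most B|xi|, which is small against |xi|^alpha near 0. Away from 0 the bounded
    derivative of D^ is absorbed by |xi|^(alpha-1), bounded below on [-pi, pi]. *)
Lemma hypI_perturb alpha (F G : Z -> R) a :
  0 < alpha < 1 -> probZp F -> probZp G -> hypI alpha F -> 0 < a ->
  ex_series (fun n => INR (S n) * Rabs (G (Z.of_nat (S n)) - a * F (Z.of_nat (S n)))) ->
  hypI alpha G.
Proof.
  intros Halpha HF HG [eps [c [Heps [Hc [Hre Hder]]]]] Ha Hex.
  destruct (probZp_series F HF) as [HFa _], (probZp_series G HG) as [HGa _].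
  set (D := fun k => G (Z.of_nat k) - a * F (Z.of_nat k)).
  assert (HaF : ex_series (fun k => Rabs (a * F (Z.of_nat k)))).
  { apply (ex_series_dom _ (fun k => a * Rabs (F (Z.of_nat k)))).
    - intros k; rewrite Rabs_mult, (Rabs_pos_eq a) by lra; apply Rle_refl.
    - exact (ex_series_scal_l a _ HFa). }
  assert (HDa : ex_series (fun k => Rabs (D k))).
  { apply (ex_series_dom _ (fun k => Rabs (G (Z.of_nat k)) + Rabs (a * F (Z.of_nat k)))).
    - intros k; unfold D, Rminus; eapply Rle_trans; [apply Rabs_triang|]; rewrite Rabs_Ropp; lra.
    - apply (ex_series_plus _ _ HGa HaF). }
  assert (HDk : ex_series (fun k => INR k * Rabs (D k))).
  { apply (ex_series_incr_1 (fun k => INR k * Rabs (D k))); exact Hex. }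
  set (B := Series (fun k => INR k * Rabs (D k))).
  assert (HGhat : forall x, Fhat G x = (RtoC a * Fhat F x + trig D x)%C).
  { intros x; unfold D.
    rewrite (trig_minus (fun k => G (Z.of_nat k)) (fun k => a * F (Z.of_nat k)) x HGa HaF), trig_scal.
    change (Fhat G x) with (trig (fun k => G (Z.of_nat k)) x).
    change (Fhat F x) with (trig (fun k => F (Z.of_nat k)) x); ring. }
  assert (Hsmooth := fun x => trig_derivative_bounded D x HDa HDk); fold B in Hsmooth.
  assert (HB : 0 <= B).
  { destruct (Hsmooth 0) as [d [_ [Hd _]]]; assert (H := Rabs_pos (fst d)); lra. }
  (* Chosen so that (B+1) r^(1-alpha) = a eps/2: for |xi| <= r the error B|xi| uses at most half of
     a eps |xi|^alpha. B + 1 replaces B to exclude a zero denominator. *)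
  set (r := Rpower (a * eps / (2 * (B + 1))) (/ (1 - alpha))).
  assert (Hr : 0 < r) by apply Rpower_pos.
  assert (Hae : 0 < a * eps) by nra.
  assert (Hac : 0 < a * c) by nra.
  (* The term a eps/2 is the half that survives. In the second constant, 8B = 4 * 2B: the derivative
     of D^ is at most 2B, and |xi|^(alpha-1) >= 1/4 because |xi| <= pi <= 4. *)
  exists (Rmin eps (Rmin r (a * eps / 2))), (a * c + 8 * B).
  set (eps' := Rmin eps (Rmin r (a * eps / 2))).
  assert (He1 : eps' <= eps) by apply Rmin_l.
  assert (He2 : eps' <= r) by (eapply Rle_trans; [apply Rmin_r|apply Rmin_l]).
  assert (He3 : eps' <= a * eps / 2) by (eapply Rle_trans; [apply Rmin_r|apply Rmin_r]).
  split; [split; [repeat apply Rmin_pos; lra|lra]|split; [lra|split]].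
  - intros xi Hxi.
    unfold powabs; destruct (Req_EM_T xi 0) as [->|Hne].
    { rewrite (Fhat_at_0 G HG); simpl; lra. }
    assert (H0 : trig D 0 = RtoC (1 - a)).
    { assert (H := HGhat 0); rewrite (Fhat_at_0 F HF), (Fhat_at_0 G HG) in H.
      transitivity (RtoC a * RtoC 1 + trig D 0 - RtoC a * RtoC 1)%C; [ring|].
      rewrite <- H, RtoC_minus; ring. }
    set (w := Rabs xi).
    assert (Hw : 0 < w) by now apply Rabs_pos_lt.
    assert (Hwe : w <= eps') by (apply Rabs_le; lra).
    assert (Hmv : Rabs (fst (trig D xi) - (1 - a)) <= B * w).
    { assert (Hd : forall z, exists d, is_derive (fun t => fst (trig D t)) z d /\ Rabs d <= B).
      { intros z; destruct (Hsmooth z) as [d [Hd [Hle _]]]; exists (fst d); split; [now apply is_derive_re|exact Hle]. }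
      replace (1 - a) with (fst (trig D 0)) by (rewrite H0; reflexivity).
      unfold w; destruct (Rle_lt_dec 0 xi) as [Hpos|Hneg].
      - rewrite (Rabs_pos_eq xi) by lra.
        assert (H := mvt_abs (fun t => fst (trig D t)) 0 xi B Hpos (fun z _ => Hd z)).
        rewrite Rminus_0_r in H; exact H.
      - rewrite (Rabs_left xi) by lra; rewrite Rabs_minus_sym.
        assert (H := mvt_abs (fun t => fst (trig D t)) xi 0 B ltac:(lra) (fun z _ => Hd z)).
        rewrite Rminus_0_l in H; exact H. }
    assert (HreF := Hre xi ltac:(lra)).
    unfold powabs in HreF; destruct (Req_EM_T xi 0) as [E|_]; [contradiction|]; fold w in HreF.
    set (X := Rpower w alpha) in *; assert (HX : 0 < X) by apply Rpower_pos.
    assert (Hwx : (B + 1) * w <= a * eps / 2 * X).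
    { set (Y := Rpower w (1 - alpha)); assert (HY : 0 < Y) by apply Rpower_pos.
      assert (Ew : w = Y * X).
      { unfold X, Y; rewrite <- Rpower_plus; replace (1 - alpha + alpha) with 1 by ring; now rewrite Rpower_1. }
      assert (HYr : Y <= a * eps / (2 * (B + 1))).
      { apply Rle_trans with (Rpower r (1 - alpha)).
        - apply Rle_Rpower_l; lra.
        - unfold r; rewrite Rpower_mult, Rinv_l, Rpower_1; [lra| |lra].
          apply Rdiv_lt_0_compat; lra. }
      apply (Rmult_le_compat_l (B + 1)) in HYr; [|lra].
      replace ((B + 1) * (a * eps / (2 * (B + 1)))) with (a * eps / 2) in HYr by (field; lra).
      rewrite Ew, <- Rmult_assoc; apply Rmult_le_compat_r; lra. }
    assert (HfG : fst (Fhat G xi) = a * fst (Fhat F xi) + fst (trig D xi)).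
    { rewrite HGhat; unfold Cplus, Cmult, RtoC; simpl; ring. }
    rewrite HfG; apply Rabs_le_between in Hmv.
    assert (eps' * X <= a * eps / 2 * X) by (apply Rmult_le_compat_r; lra).
    assert (a * (1 - fst (Fhat F xi)) >= a * (eps * X)) by (apply Rmult_ge_compat_l; lra).
    nra.
  - intros xi Hxi Hne.
    destruct (Hder xi Hxi Hne) as [df [Hdf Hdfle]], (Hsmooth xi) as [dd [Hdd [_ Hddle]]].
    exists (RtoC a * df + dd)%C; split.
    + apply (is_derive_ext (fun t => RtoC a * Fhat F t + trig D t)%C); [intros t; symmetry; apply HGhat|].
      apply (is_derive_plus (V := C_R_NormedModule) (fun t => RtoC a * Fhat F t)%C (trig D)); [|exact Hdd].
      replace (RtoC a * df)%C with (RtoC 0 * Fhat F xi + RtoC a * df)%C by ring.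
      apply (is_derive_Cmult (fun _ => RtoC a)); [|exact Hdf].
      exact (@is_derive_const R_AbsRing C_R_NormedModule (RtoC a) xi).
    + eapply Rle_trans; [apply Cmod_triangle|].
      rewrite Cmod_mult, Cmod_R, (Rabs_pos_eq a) by lra.
      set (q := Rpower (Rabs xi) (alpha - 1)) in *.
      assert (Hq : / 4 <= q).
      { assert (Hw : 0 < Rabs xi) by now apply Rabs_pos_lt.
        assert (Hw4 : Rabs xi <= 4) by (assert (HPI := PI_4); apply Rabs_le; lra).
        unfold q; replace (alpha - 1) with (- (1 - alpha)) by ring.
        apply Rle_trans with (Rpower 4 (- (1 - alpha))); [|apply Rpower_neg_le; lra].
        rewrite Rpower_Ropp; apply Rinv_le_contravar; [apply Rpower_pos|apply Rpower_le_id; lra]. }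
      apply (Rmult_le_compat_l a) in Hdfle; [|lra]; nra.
Qed.

Theorem theorem5p1 (alpha : R) (Halpha : 0 < alpha < 1) :
  (forall F : Z -> R, probZp F -> aperiodic F -> hypI alpha F -> classA F) /\
  (forall F G : Z -> R, probZp F -> probZp G -> aperiodic F -> aperiodic G ->
     hypI alpha F ->
     forall a : R, 0 < a ->
     ex_series (fun n : nat =>
        INR (S n) * Rabs (G (Z.of_nat (S n)) - a * F (Z.of_nat (S n)))) ->
     hypI alpha G /\ classA G).
Proof.
  split.
  - intros F HF Hap Hhyp; exact (hypI_classA alpha F Halpha HF Hap Hhyp).
  - intros F G HF HG _ HapG Hhyp a Ha Hex.
    assert (HhypG := hypI_perturb alpha F G a Halpha HF HG Hhyp Ha Hex).
    split; [exact HhypG|exact (hypI_classA alpha G Halpha HG HapG HhypG)].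
Qed.
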